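(* Fix $n\ge1$. There exist $\epsilon_0>0$ and a function $K\colon[0,\epsilon_0)\to[0,\infty)$ with $K(\epsilon)\to0^+$ as $\epsilon\to0^+$ such that for every $0\le\epsilon<\epsilon_0$ the following holds: if a linear map $\Phi\colon\mathbb{R}^{2n}\to\mathbb{R}^{2n}$ has both the linear $\epsilon$-non-squeezing property and the linear $\epsilon$-non-expanding property, then, with $\epsilon'=K(\epsilon)$, $\Phi$ is either $\epsilon'$-symplectic or $\epsilon'$-anti-symplectic.
   Context: $\mathbb{R}^{2n}$ carries the standard metric and the standard symplectic form $\omega_0=\sum_{j=1}^n dx_j\wedge dy_j$. For a two-form with constant coefficients, $\|\cdot\|_2$ is the Euclidean norm of its coefficient vector in the basis of wedge products (with increasing indices) of the standard orthonormal coframe. A linear map $\Phi$ is $\epsilon$-symplectic if $\|\Phi^*\omega_0-\omega_0\|_2\le\epsilon$ and $\epsilon$-anti-symplectic if $\|\Phi^*\omega_0+\omega_0\|_2\le\epsilon$. $\|A\|$ is the operator norm of a matrix. $B_r^{2n}$ is the closed ball of radius $r$ centered at the origin. For a non-singular real $2n\times2n$ matrix $A$, $E(A)=AB_1^{2n}$ is the associated ellipsoid centered at the origin. For each such $E(A)$ there is a linear symplectic map $\Psi$ with $\Psi E(A)=\{z\in\mathbb{C}^n\mid\sum_j|z_j/r_j|^2\le1\}$ for a unique tuple $0<r_1\le\dots\le r_n$ (where $\mathbb{R}^{2n}=\mathbb{C}^n$, $z_j=x_j+iy_j$); this tuple is the symplectic spectrum of $E(A)$ and $r_1$ is its linear symplectic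 width. For a degenerate ellipsoid (image of $B_1^{2n}$ under a singular matrix) the linear symplectic width is $0$. Definition. Let $0\le\epsilon<1$ and $\rho=\sqrt{1-\epsilon}$. For a non-singular matrix $A$ let $r_A>0$ be the smallest number with $E(A)\subset B_{r_A}^{2n}$, let $s_A=(1+\|A^{-1}\|(\rho^{-1}-1)r_A)^{-1}$, and, if $\|A^{-1}\|(\rho^{-1}-1)r_A<1$, let $e_A=(1-\|A^{-1}\|(\rho^{-1}-1)r_A)^{-1}$. (a) A linear map $\Phi$ has the linear $\epsilon$-non-squeezing property if for every ellipsoid $E(A)$ ($A$ non-singular) with linear symplectic width $r_1$, the linear symplectic width $R_1$ of $\Phi E(A)$ satisfies $s_A r_1\le R_1$. (b) $\Phi$ has the linear $\epsilon$-non-expanding property if for every $r>0$ the linear symplectic width of $\Phi B_r^{2n}$ is at most $\rho^{-1}r$, and moreover for every ellipsoid $E(A)$ ($A$ non-singular) with linear symplectic width $r_1$ and $\|A^{-1}\|(\rho^{-1}-1)r_A<1$, the linear symplectic width $R_1$ of $\Phi E(A)$ satisfies $R_1\le e_A r_1$. *)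

(* Defs.v *)
From HB Require Import structures.
From mathcomp Require Import all_boot all_order all_algebra.
From mathcomp Require Import all_classical all_reals all_analysis.

Set Implicit Arguments.
Unset Strict Implicit.
Unset Printing Implicit Defensive.

Import Order.TTheory GRing.Theory Num.Theory.
Import numFieldNormedType.Exports.

Local Open Scope classical_set_scope.
Local Open Scope ring_scope.

(* R^{2n} is 'cV[R]_(n + n), with coordinates (x_1, .., x_n, y_1, .., y_n). *)
Section Symplectic.
Context {R : realType}.

Definition xcoord n (v : 'cV[R]_(n + n)) (j : 'I_n) : R := v (lshift n j) 0.
Definition ycoord n (v : 'cV[R]_(n + n)) (j : 'I_n) : R := v (rshift n j) 0.

(* The canonical norm of a matrix type in MathComp-Analysis is the sup norm,
   so the Euclidean norm has to be defined separately. *)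
Definition enorm m (v : 'cV[R]_m) : R := Num.sqrt (\sum_i v i 0 ^+ 2).

Definition eball m (r : R) : set 'cV[R]_m := [set v | enorm v <= r].

Definition opnorm m (A : 'M[R]_m) : R :=
  sup [set enorm (A *m v) | v in eball 1].

Definition omega0 n (u v : 'cV[R]_(n + n)) : R :=
  \sum_(j < n) (xcoord u j * ycoord v j - ycoord u j * xcoord v j).

Definition pullback m (Phi : 'cV[R]_m -> 'cV[R]_m)
    (w : 'cV[R]_m -> 'cV[R]_m -> R) : 'cV[R]_m -> 'cV[R]_m -> R :=
  fun u v => w (Phi u) (Phi v).

(* The coefficient of a two-form w on e_i^* /\ e_j^*, i < j, is w e_i e_j. *)
Definition form_norm m (w : 'cV[R]_m -> 'cV[R]_m -> R) : R :=
  Num.sqrt (\sum_(i < m) \sum_(j < m | (i < j)%N)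
    w (delta_mx i 0) (delta_mx j 0) ^+ 2).

Definition eps_symplectic n (eps : R)
    (Phi : {linear 'cV[R]_(n + n) -> 'cV[R]_(n + n)}) : Prop :=
  form_norm (fun u v => pullback Phi (@omega0 n) u v - omega0 u v) <= eps.

Definition eps_antisymplectic n (eps : R)
    (Phi : {linear 'cV[R]_(n + n) -> 'cV[R]_(n + n)}) : Prop :=
  form_norm (fun u v => pullback Phi (@omega0 n) u v + omega0 u v) <= eps.

Definition symplectic n
    (Psi : {linear 'cV[R]_(n + n) -> 'cV[R]_(n + n)}) : Prop :=
  forall u v, pullback Psi (@omega0 n) u v = omega0 u v.

Definition ellipsoid m (A : 'M[R]_m) : set 'cV[R]_m :=
  [set A *m v | v in eball 1].

(* |z_j / r_j|^2 is written in real coordinates, z_j = x_j + i y_j. *)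
Definition std_ellipsoid n (r : n.-tuple R) : set 'cV[R]_(n + n) :=
  [set v | \sum_(j < n)
     (xcoord v j ^+ 2 + ycoord v j ^+ 2) / tnth r j ^+ 2 <= 1].

Definition symplectic_spectrum n (E : set 'cV[R]_(n + n)) (r : n.-tuple R) :
    Prop :=
  [/\ forall j, 0 < tnth r j, sorted <=%R r &
      exists2 Psi : {linear 'cV[R]_(n + n) -> 'cV[R]_(n + n)},
        symplectic Psi & Psi @` E = std_ellipsoid r].

(* [linear_width E w]: the ellipsoid E, possibly degenerate, has linear
   symplectic width w.  The spectrum is sorted, so its first entry r`_0 is
   the r_1 of the literature. *)
Definition linear_width n (E : set 'cV[R]_(n + n)) (w : R) : Prop :=
  (exists A, [/\ A \in unitmx, E = ellipsoid A &
     exists2 r : n.-tuple R, symplectic_spectrum E r & w = r`_0]) \/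
  (exists A, [/\ A \notin unitmx, E = ellipsoid A & w = 0]).

(* For A != 0 the infimum is attained: it is the smallest such radius. *)
Definition circumradius m (A : 'M[R]_m) : R :=
  inf [set r | 0 < r /\ ellipsoid A `<=` eball r].

Definition rho (eps : R) : R := Num.sqrt (1 - eps).

Definition distortion m (eps : R) (A : 'M[R]_m) : R :=
  opnorm (invmx A) * ((rho eps)^-1 - 1) * circumradius A.

Definition s_factor m (eps : R) (A : 'M[R]_m) : R := (1 + distortion eps A)^-1.
Definition e_factor m (eps : R) (A : 'M[R]_m) : R := (1 - distortion eps A)^-1.

Definition linear_non_squeezing n (eps : R)
    (Phi : {linear 'cV[R]_(n + n) -> 'cV[R]_(n + n)}) : Prop :=
  forall (A : 'M[R]_(n + n)) (r1 R1 : R), A \in unitmx ->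
    linear_width (ellipsoid A) r1 -> linear_width (Phi @` ellipsoid A) R1 ->
    s_factor eps A * r1 <= R1.

Definition linear_non_expanding n (eps : R)
    (Phi : {linear 'cV[R]_(n + n) -> 'cV[R]_(n + n)}) : Prop :=
  (forall r R1 : R, 0 < r ->
     linear_width (Phi @` eball r) R1 -> R1 <= (rho eps)^-1 * r) /\
  (forall (A : 'M[R]_(n + n)) (r1 R1 : R), A \in unitmx ->
     distortion eps A < 1 ->
     linear_width (ellipsoid A) r1 -> linear_width (Phi @` ellipsoid A) R1 ->
     R1 <= e_factor eps A * r1).

End Symplectic.

(* Main.v *)
Require Import Defs.
From HB Require Import structures.
From mathcomp Require Import all_boot all_order all_algebra.
From mathcomp Require Import all_classical all_reals all_analysis.
From mathcomp Require Import ring lra.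

Set Implicit Arguments.
Unset Strict Implicit.
Unset Printing Implicit Defensive.

Import Order.TTheory GRing.Theory Num.Theory.
Import numFieldNormedType.Exports.

Local Open Scope classical_set_scope.
Local Open Scope ring_scope.

(** The linear symplectic width of an ellipsoid is a spectral quantity.  Let J be
    the matrix of omega_0 and B = A^-1.  Then the width r_1 of E(A) satisfies
    r_1^-2 = |B J B^T| (operator norm), which is Williamson's normal form read
    off for the smallest radius ([linear_width_opnorm]).  If P is the matrix of
    Phi, non-squeezing forces P to be invertible, and the width of Phi E(A) is
    given by the same formula with J replaced by the skew matrix
    G = P^-1 J P^-T.  So the two hypotheses compare the norms of B J B^T and
    B G B^T, with a factor 1 + O(eps cond A).

    These norms can be made to see a single value of the form.  Let B = D C with
    C fixed and D the diagonal matrix that keeps the coordinates i, j and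
    multiplies the others by a small t.  Since C J C^T and C G C^T are skew,
    D (C J C^T) D is, up to O(t), a single pair of opposite entries, and its
    norm is the absolute value of the (i, j) entry of C J C^T; likewise for G.
    The condition number of A is O(1 / t), so the entries of C G C^T and
    C J C^T agree in absolute value up to O(t + eps / t)
    ([pair_estimate]), that is O(sqrt eps) for t of the order of sqrt eps.

    With C = 1 every entry of G is that of J up to sign and error.  To see that
    the sign is the same for all the symplectic pairs (e_a, f_a), take for C a
    shear whose rows are e_a + e_k and f_a + f_k: the value of the form there is
    close to G(e_a, f_a) + G(e_k, f_k) and must be close to 2 in absolute value
    ([close_to_Jmx]).  Hence G is close to s J with s = 1 or s = -1, and so is
    P^T J P = - G^-1, the matrix of Phi^* omega_0 ([inverse_close_to_Jmx]).

    This gives K(eps) = c (sqrt eps), where c depends on n only.  At eps = 0 the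
    estimate holds for all small t, so one of the two defects vanishes. *)

(** * Euclidean, operator and entrywise norms *)

Section EuclideanNorm.
Context {R : realType}.

Definition dot m (u v : 'cV[R]_m) : R := (u^T *m v) 0 0.

Lemma dotE m (u v : 'cV[R]_m) : dot u v = \sum_i u i 0 * v i 0.
Proof. by rewrite /dot mxE; apply: eq_bigr => i _; rewrite mxE. Qed.

Lemma dotC m (u v : 'cV[R]_m) : dot u v = dot v u.
Proof. by rewrite !dotE; apply: eq_bigr => i _; rewrite mulrC. Qed.

Lemma dotDr m (u v w : 'cV[R]_m) : dot u (v + w) = dot u v + dot u w.
Proof. by rewrite /dot mulmxDr mxE. Qed.

Lemma dotZr m a (u v : 'cV[R]_m) : dot u (a *: v) = a * dot u v.
Proof. by rewrite /dot -scalemxAr mxE. Qed.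

Lemma dotNr m (u v : 'cV[R]_m) : dot u (- v) = - dot u v.
Proof. by rewrite /dot mulmxN mxE. Qed.

Lemma dotDl m (u v w : 'cV[R]_m) : dot (v + w) u = dot v u + dot w u.
Proof. by rewrite dotC dotDr !(dotC u). Qed.

Lemma dotZl m a (u v : 'cV[R]_m) : dot (a *: v) u = a * dot v u.
Proof. by rewrite dotC dotZr (dotC u). Qed.

Lemma dotNl m (u v : 'cV[R]_m) : dot (- v) u = - dot v u.
Proof. by rewrite dotC dotNr (dotC u). Qed.

Lemma dot_mulmxr m p (M : 'M[R]_(m, p)) u v : dot u (M *m v) = dot (M^T *m u) v.
Proof. by rewrite /dot trmx_mul trmxK mulmxA. Qed.

Lemma dot_ge0 m (u : 'cV[R]_m) : 0 <= dot u u.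
Proof. by rewrite dotE; apply: sumr_ge0 => i _; rewrite -expr2 sqr_ge0. Qed.

Lemma dot_eq0 m (u : 'cV[R]_m) : (dot u u == 0) = (u == 0).
Proof.
apply/eqP/eqP => [|->]; last by rewrite /dot mulmx0 mxE.
rewrite dotE => u0; apply/colP => i; rewrite mxE; apply/eqP.
rewrite -[_ == _]sqrf_eq0 expr2; apply/eqP; move: i isT; apply/psumr_eq0P => //.
by move=> i _; rewrite -expr2 sqr_ge0.
Qed.

Lemma dot_gt0 m (u : 'cV[R]_m) : (0 < dot u u) = (u != 0).
Proof. by rewrite lt_def dot_ge0 andbT dot_eq0. Qed.

Lemma dot_delta m (i : 'I_m) (u : 'cV[R]_m) : dot (delta_mx i 0) u = u i 0.
Proof. by rewrite /dot trmx_delta -rowE mxE. Qed.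

Lemma mx_entry_dot m p (M : 'M[R]_(m, p)) i j :
  M i j = dot (delta_mx i 0) (M *m delta_mx j 0).
Proof. by rewrite dot_delta -colE mxE. Qed.

Lemma enormE m (v : 'cV[R]_m) : enorm v = Num.sqrt (dot v v).
Proof. by rewrite /enorm dotE; congr Num.sqrt; apply: eq_bigr => i _; rewrite expr2. Qed.

Lemma enorm_ge0 m (v : 'cV[R]_m) : 0 <= enorm v.
Proof. exact: sqrtr_ge0. Qed.

Lemma sqr_enorm m (v : 'cV[R]_m) : enorm v ^+ 2 = dot v v.
Proof. by rewrite enormE sqr_sqrtr ?dot_ge0. Qed.

Lemma enorm_gt0 m (v : 'cV[R]_m) : (0 < enorm v) = (v != 0).
Proof. by rewrite enormE sqrtr_gt0 dot_gt0. Qed.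

Lemma enorm0 m : enorm (0 : 'cV[R]_m) = 0.
Proof. by rewrite enormE /dot mulmx0 mxE sqrtr0. Qed.

Lemma enorm_le m p (u : 'cV[R]_m) (v : 'cV[R]_p) :
  (enorm u <= enorm v) = (dot u u <= dot v v).
Proof. by rewrite !enormE ler_sqrt ?dot_ge0. Qed.

Lemma enormZ m a (v : 'cV[R]_m) : enorm (a *: v) = `|a| * enorm v.
Proof. by rewrite !enormE dotZl dotZr mulrA -expr2 sqrtrM ?sqr_ge0// sqrtr_sqr. Qed.

Lemma enormN m (v : 'cV[R]_m) : enorm (- v) = enorm v.
Proof. by rewrite !enormE dotNl dotNr opprK. Qed.

Lemma cauchy_schwarz m (u v : 'cV[R]_m) : dot u v <= enorm u * enorm v.
Proof.
have [->|v0] := eqVneq v 0; first by rewrite /dot mulmx0 mxE mulr_ge0 ?enorm_ge0.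
have [uv0|/ltW uv0] := leP (dot u v) 0.
  by apply: le_trans uv0 _; rewrite mulr_ge0 ?enorm_ge0.
rewrite -(@ler_pXn2r _ 2) ?nnegrE ?mulr_ge0 ?enorm_ge0//.
rewrite exprMn !sqr_enorm.
have := dot_ge0 (dot v v *: u - dot u v *: v).
rewrite !(dotDl, dotDr, dotNl, dotNr, dotZl, dotZr) (dotC v u).
have : 0 < dot v v by rewrite dot_gt0.
move: (dot u u) (dot v v) (dot u v) => a b c b0 H.
rewrite -subr_ge0 -(pmulr_rge0 _ b0); apply: le_trans H _.
by rewrite le_eqVlt; apply/orP; left; apply/eqP; ring.
Qed.

Lemma enormD m (u v : 'cV[R]_m) : enorm (u + v) <= enorm u + enorm v.
Proof.
rewrite -(@ler_pXn2r _ 2) ?nnegrE ?addr_ge0 ?enorm_ge0//.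
rewrite sqrrD !sqr_enorm !(dotDl, dotDr) (dotC v u).
have := cauchy_schwarz u v; lra.
Qed.

Lemma norm_coord_le m (v : 'cV[R]_m) i : `|v i 0| <= enorm v.
Proof.
rewrite -sqrtr_sqr /enorm ler_sqrt ?sumr_ge0//; last by move=> *; exact: sqr_ge0.
by rewrite (bigD1 i)//= lerDl sumr_ge0// => *; exact: sqr_ge0.
Qed.

Lemma enorm_delta m (i : 'I_m) : enorm (delta_mx i 0 : 'cV[R]_m) = 1.
Proof. by rewrite enormE dot_delta mxE !eqxx sqrtr1. Qed.

(** Submultiplicative, and an upper bound for both the operator norm and the norm
    of two-forms: it serves for every estimate in which constants depending on
    the dimension are harmless. *)
Definition entry_norm m p (A : 'M[R]_(m, p)) : R := \sum_i \sum_j `|A i j|.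

Lemma entry_norm_ge0 m p (A : 'M[R]_(m, p)) : 0 <= entry_norm A.
Proof. by apply: sumr_ge0 => i _; apply: sumr_ge0. Qed.

Lemma entry_normD m p (A B : 'M[R]_(m, p)) :
  entry_norm (A + B) <= entry_norm A + entry_norm B.
Proof.
rewrite /entry_norm -big_split/=; apply: ler_sum => i _.
by rewrite -big_split/=; apply: ler_sum => j _; rewrite mxE ler_normD.
Qed.

Lemma entry_normZ m p a (A : 'M[R]_(m, p)) :
  entry_norm (a *: A) = `|a| * entry_norm A.
Proof.
rewrite /entry_norm mulr_sumr; apply: eq_bigr => i _.
by rewrite mulr_sumr; apply: eq_bigr => j _; rewrite mxE normrM.
Qed.

Lemma entry_norm_tr m p (A : 'M[R]_(m, p)) : entry_norm A^T = entry_norm A.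
Proof.
rewrite /entry_norm exchange_big; apply: eq_bigr => i _.
by apply: eq_bigr => j _; rewrite mxE.
Qed.

Lemma entry_normM m p q (A : 'M[R]_(m, p)) (B : 'M[R]_(p, q)) :
  entry_norm (A *m B) <= entry_norm A * entry_norm B.
Proof.
rewrite /entry_norm mulr_suml; apply: ler_sum => i _.
apply: (@le_trans _ _ (\sum_k \sum_j `|A i j| * `|B j k|)).
  apply: ler_sum => k _; rewrite mxE; apply: le_trans (ler_norm_sum _ _ _) _.
  by apply: ler_sum => j _; rewrite normrM.
rewrite exchange_big/= mulr_suml; apply: ler_sum => j _.
rewrite -mulr_sumr ler_wpM2l// (bigD1 j)//= lerDl.
by apply: sumr_ge0 => l _; apply: sumr_ge0.
Qed.

Lemma entry_norm_bound m p (A : 'M[R]_(m, p)) c :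
  (forall i j, `|A i j| <= c) -> entry_norm A <= (m * p)%:R * c.
Proof.
move=> Ac; apply: (@le_trans _ _ (\sum_(i < m) \sum_(j < p) c)).
  by apply: ler_sum => i _; apply: ler_sum.
by rewrite !sumr_const !card_ord -mulrnA mulr_natl mulnC.
Qed.

Lemma entry_le_entry_norm m p (A : 'M[R]_(m, p)) i j : `|A i j| <= entry_norm A.
Proof.
rewrite /entry_norm (bigD1 i)//= (bigD1 j)//= -addrA lerDl.
by rewrite addr_ge0 ?sumr_ge0// => k _; apply: sumr_ge0.
Qed.

Lemma enorm_le_entry_norm m (v : 'cV[R]_m) : enorm v <= entry_norm v.
Proof.
have -> : entry_norm v = \sum_i `|v i 0|.
  by apply: eq_bigr => i _; rewrite big_ord1.
rewrite -(@ler_pXn2r _ 2) ?nnegrE ?enorm_ge0 ?sumr_ge0//.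
rewrite sqr_enorm dotE expr2 mulr_suml; apply: ler_sum => i _.
rewrite -expr2 -real_normK ?num_real// expr2 ler_wpM2l// (bigD1 i)//= lerDl.
exact: sumr_ge0.
Qed.

Lemma enorm_mulmx_entry_norm m p (A : 'M[R]_(m, p)) v :
  enorm (A *m v) <= entry_norm A * enorm v.
Proof.
apply: le_trans (enorm_le_entry_norm _) _.
rewrite /entry_norm mulr_suml; apply: ler_sum => i _.
rewrite big_ord1 mxE mulr_suml; apply: le_trans (ler_norm_sum _ _ _) _.
by apply: ler_sum => j _; rewrite normrM ler_wpM2l// norm_coord_le.
Qed.

Lemma opnorm_has_sup m (A : 'M[R]_m) :
  has_sup [set enorm (A *m v) | v in eball 1].
Proof.
split; first by exists 0, 0; rewrite /eball/= ?mulmx0 enorm0.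
exists (entry_norm A) => _ [v /= v1 <-].
apply: le_trans (enorm_mulmx_entry_norm _ _) _.
by rewrite ler_piMr ?entry_norm_ge0.
Qed.

Lemma opnorm_ge0 m (A : 'M[R]_m) : 0 <= opnorm A.
Proof.
apply: ub_le_sup; first by case: (opnorm_has_sup A).
by exists 0; rewrite /eball/= ?mulmx0 enorm0.
Qed.

Lemma enorm_mulmx_opnorm m (A : 'M[R]_m) v : enorm (A *m v) <= opnorm A * enorm v.
Proof.
have [->|v0] := eqVneq v 0; first by rewrite mulmx0 enorm0 mulr0.
have ev : 0 < enorm v by rewrite enorm_gt0.
rewrite -ler_pdivrMr//.
apply: ub_le_sup; first by case: (opnorm_has_sup A).
exists ((enorm v)^-1 *: v).
  by rewrite /eball/= enormZ gtr0_norm ?invr_gt0// mulVf// gt_eqF.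
by rewrite -scalemxAr enormZ gtr0_norm ?invr_gt0// mulrC.
Qed.

Lemma opnorm_le m (A : 'M[R]_m) c :
  0 <= c -> (forall v, enorm (A *m v) <= c * enorm v) -> opnorm A <= c.
Proof.
move=> c0 Ac; apply: ge_sup; first by case: (opnorm_has_sup A).
by move=> _ [v /= v1 <-]; apply: le_trans (Ac v) _; rewrite ler_piMr.
Qed.

Lemma opnorm_le_entry_norm m (A : 'M[R]_m) : opnorm A <= entry_norm A.
Proof.
by apply: opnorm_le => [|v]; [exact: entry_norm_ge0|exact: enorm_mulmx_entry_norm].
Qed.

Lemma entry_le_opnorm m (A : 'M[R]_m) i j : `|A i j| <= opnorm A.
Proof.
have := enorm_mulmx_opnorm A (delta_mx j 0).
rewrite enorm_delta mulr1; apply: le_trans.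
by rewrite -colE; have := norm_coord_le (col j A) i; rewrite mxE.
Qed.

Lemma opnormD m (A B : 'M[R]_m) : opnorm (A + B) <= opnorm A + opnorm B.
Proof.
apply: opnorm_le => [|v]; first by rewrite addr_ge0 ?opnorm_ge0.
rewrite mulmxDl mulrDl; apply: le_trans (enormD _ _) _.
by rewrite lerD ?enorm_mulmx_opnorm.
Qed.

End EuclideanNorm.

(** * Normal form of an invertible skew matrix *)

Section SkewNormalForm.
Context {R : realType}.

Lemma continuous_sumr (T : topologicalType) (I : Type) (r : seq I) (F : I -> T -> R) :
  (forall i, continuous (F i)) -> continuous (fun x => \sum_(i <- r) F i x).
Proof. by move=> cF; apply: continuous_big => [|i _]; [exact: add_continuous|exact: cF]. Qed.

Lemma continuous_sqr_norm_mulmx m k (M : 'M[R]_(k, m)) :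
  continuous (fun v : 'rV[R]_m => dot (M *m v^T) (M *m v^T)).
Proof.
have lin i : continuous (fun w : 'rV[R]_m => (M *m w^T) i 0).
  have -> : (fun w => (M *m w^T) i 0) = (fun w : 'rV[R]_m => \sum_j M i j * w 0 j).
    by apply/funext => w; rewrite mxE; apply: eq_bigr => j _; rewrite mxE.
  apply: continuous_sumr => j w.
  by apply: continuousM; [exact: cst_continuous|exact: coord_continuous].
under eq_fun => v do rewrite dotE.
by apply: continuous_sumr => i v; apply: continuousM; exact: lin.
Qed.

(** Compactness of the unit sphere of ker C, which is nonempty because C has fewer
    rows than columns. *)
Lemma min_on_sphere m k (C : 'M[R]_(k, m)) (S : 'M[R]_m) : (k < m)%N ->
  exists x : 'cV[R]_m, [/\ C *m x = 0, dot x x = 1 &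
    forall y, C *m y = 0 -> dot (S *m x) (S *m x) * dot y y <= dot (S *m y) (S *m y)].
Proof.
move=> km.
pose f k (M : 'M[R]_(k, m)) (v : 'rV[R]_m) := dot (M *m v^T) (M *m v^T).
pose A := (f _ C @^-1` [set 0]) `&` (f _ 1%:M @^-1` [set 1]).
have normA (y : 'cV[R]_m) : C *m y = 0 -> y != 0 -> A ((enorm y)^-1 *: y)^T.
  move=> Cy y0; have ey : enorm y != 0 by rewrite gt_eqF ?enorm_gt0.
  split; rewrite /f/= trmxK -scalemxAr ?Cy ?scaler0 ?mul1mx.
    by rewrite /dot mulmx0 mxE.
  by rewrite dotZl dotZr -sqr_enorm mulrA -invfM -expr2 mulVf// expf_neq0.
have A0 : A !=set0.
  have : kermx C^T != 0.
    rewrite -mxrank_eq0 mxrank_ker -lt0n subn_gt0.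
    exact: leq_ltn_trans (rank_leq_col _) km.
  rewrite -nz_row_eq0 => w0.
  exists ((enorm (nz_row (kermx C^T))^T)^-1 *: (nz_row (kermx C^T))^T)^T.
  apply: normA; last by rewrite -(inj_eq trmx_inj) trmxK trmx0.
  apply: trmx_inj; rewrite trmx_mul trmxK trmx0; apply/sub_kermxP.
  exact: nz_row_sub.
have cA : compact A.
  apply: bounded_closed_compact.
    exists 1; split; first exact: num_real.
    move=> M M1 v [_]; rewrite /f/= mul1mx => v1.
    apply: le_trans (ltW M1); rewrite [leLHS]mx_normrE; apply: bigmax_le => //= -[i j] _ /=.
    have := norm_coord_le v^T j; rewrite mxE enormE v1 sqrtr1.
    by rewrite (ord1 i).
  apply: closedI; apply: preimage_closed; last 2 first.
  - by move=> v _; exact: continuous_sqr_norm_mulmx.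
  - exact: closed_eq.
  - by move=> v _; exact: continuous_sqr_norm_mulmx.
  - exact: closed_eq.
have cf : {within A, continuous (f _ S)}.
  by apply: continuous_subspaceT; exact: continuous_sqr_norm_mulmx.
have [x /set_mem[/= Cx x1] xmin] := EVT_min_rV A0 cA cf.
exists x^T; split.
- by apply/eqP; rewrite -dot_eq0; apply/eqP.
- by move: x1; rewrite /f mul1mx.
move=> y Cy; have [->|y0] := eqVneq y 0.
  by rewrite !mulmx0 /dot !mulmx0 !mxE mulr0.
have := xmin _ (mem_set (normA _ Cy y0)).
rewrite /f trmxK -!scalemxAr !(dotZl, dotZr) mulrA -invfM -expr2 sqr_enorm.
by rewrite mulrC ler_pdivlMr// dot_gt0.
Qed.

(** The quadratic form y |-> |S y|^2 - |S x|^2 |y|^2 is nonnegative on ker C and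
    vanishes at x, hence so does its polarization at x. *)
Lemma min_on_sphere_stationary m k (C : 'M[R]_(k, m)) (S : 'M[R]_m) x :
  C *m x = 0 -> dot x x = 1 ->
  (forall y, C *m y = 0 -> dot (S *m x) (S *m x) * dot y y <= dot (S *m y) (S *m y)) ->
  forall y, C *m y = 0 -> dot (S *m x) (S *m y) = dot (S *m x) (S *m x) * dot x y.
Proof.
move=> Cx x1 xmin y Cy.
pose l := dot (S *m x) (S *m x).
pose b := dot (S *m x) (S *m y) - l * dot x y.
pose c := dot (S *m y) (S *m y) - l * dot y y.
have c0 : 0 <= c by rewrite subr_ge0 xmin.
have key t : 0 <= t * (2 * b + t * c).
  have : C *m (x + t *: y) = 0 by rewrite mulmxDr -scalemxAr Cx Cy scaler0 addr0.
  move=> /xmin; rewrite -/l mulmxDr -scalemxAr !(dotDl, dotDr, dotZl, dotZr) x1.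
  rewrite (dotC y x) (dotC (S *m y)) -subr_ge0 -/l /b /c => H.
  by apply: le_trans H _; rewrite le_eqVlt; apply/orP; left; apply/eqP; ring.
suff : b = 0 by move/subr0_eq.
apply/eqP/negPn/negP => b0.
(* Minimizing over t would give t = - b / c; c + 1 avoids dividing by 0. *)
have c1 : 0 < c + 1 by rewrite ltr_wpDl.
have := key (- b / (c + 1)).
have -> : - b / (c + 1) * (2 * b + - b / (c + 1) * c) =
   - (b ^+ 2 * (c + 2) / (c + 1) ^+ 2) by field; rewrite gt_eqF.
rewrite oppr_ge0 leNgt divr_gt0 ?exprn_gt0// mulr_gt0//; last by lra.
by rewrite lt_def sqrf_eq0 b0 sqr_ge0.
Qed.

(** The first k planes of the normal form, chosen greedily.  The last clause says
    that d i is the least dilation factor of S on the complement of the earlier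
    planes; for i = 0 this is the whole space. *)
Definition skew_pairs m (S : 'M[R]_m) k (u v : nat -> 'cV[R]_m) (d : nat -> R) :=
  [/\ forall i, (i < k)%N -> [/\ 0 < d i, S *m u i = - d i *: v i & S *m v i = d i *: u i],
      forall i j, (i < k)%N -> (j < k)%N ->
        [/\ dot (u i) (u j) = (i == j)%:R, dot (v i) (v j) = (i == j)%:R
           & dot (u i) (v j) = 0],
      forall i j, (i <= j < k)%N -> d i <= d j &
      forall i x, (i < k)%N -> (forall j, (j < i)%N -> dot (u j) x = 0 /\ dot (v j) x = 0) ->
        d i ^+ 2 * dot x x <= dot (S *m x) (S *m x)].

Lemma dot_skewC m (S : 'M[R]_m) (Sskew : S^T = - S) x y :
  dot x (S *m y) = - dot (S *m x) y.
Proof. by rewrite dot_mulmxr Sskew mulNmx dotNl. Qed.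

Lemma dot_skew0 m (S : 'M[R]_m) (Sskew : S^T = - S) x : dot x (S *m x) = 0.
Proof. have := dot_skewC Sskew x x; rewrite (dotC (S *m x)); lra. Qed.

(** A minimizer x of |S x| on the complement of the earlier planes, which S
    preserves, is an eigenvector of S^2: the first-order condition makes
    S^2 x + |S x|^2 x orthogonal to itself.  Then x and S x span the next
    plane. *)
Lemma skew_pair_step m (S : 'M[R]_m) k u v d : S^T = - S -> S \in unitmx ->
  (k + k < m)%N -> skew_pairs S k u v d -> exists u' v' d', skew_pairs S k.+1 u' v' d'.
Proof.
move=> Sskew Su km [eig orth mono dmin].
pose C := col_mx (\matrix_(i < k) (u i)^T) (\matrix_(i < k) (v i)^T).
have CP x : C *m x = 0 <-> forall j, (j < k)%N -> dot (u j) x = 0 /\ dot (v j) x = 0.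
  have rowE (w : nat -> 'cV[R]_m) (j : 'I_k) :
      ((\matrix_(i < k) (w i)^T) *m x) j 0 = dot (w j) x.
    by rewrite /dot !mxE; apply: eq_bigr => l _; rewrite !mxE.
  split=> [/eqP|Cx]; rewrite /C mul_col_mx.
    rewrite col_mx_eq0 => /andP[/eqP/colP ux /eqP/colP vx] j jk.
    have := ux (Ordinal jk); have := vx (Ordinal jk).
    by rewrite !rowE !mxE.
  apply/eqP; rewrite col_mx_eq0; apply/andP.
  by split; apply/eqP/colP => j; rewrite rowE mxE; case: (Cx j (ltn_ord j)).
have Sinv (x : 'cV[R]_m) : C *m x = 0 -> C *m (S *m x) = 0.
  move=> /CP Cx; apply: (CP _).2 => j jk; have [_ Su' Sv'] := eig _ jk; have [ux vx] := Cx _ jk.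
  by rewrite !(dot_skewC Sskew) Su' Sv' !dotZl ux vx !mulr0 !oppr0.
have [x [Cx x1 xmin]] := min_on_sphere C S km.
have stat := min_on_sphere_stationary Cx x1 xmin.
pose l := dot (S *m x) (S *m x).
have l0 : 0 < l.
  rewrite dot_gt0; apply/eqP => Sx0.
  have x0 : x = 0 by rewrite -(mulKmx Su x) Sx0 mulmx0.
  by move: x1; rewrite x0 /dot mulmx0 mxE => /eqP; rewrite eq_sym oner_eq0.
have SSx : S *m (S *m x) = - l *: x.
  pose z := S *m (S *m x) + l *: x.
  have Cz : C *m z = 0 by rewrite mulmxDr -scalemxAr Cx scaler0 addr0; rewrite !Sinv.
  suff : z = 0 by move/eqP; rewrite addr_eq0 scaleNr => /eqP.
  apply/eqP; rewrite -dot_eq0 {2}/z dotDr dotZr (dot_skewC Sskew) dotC stat//.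
  by rewrite (dotC x) addrC subrr.
pose a := Num.sqrt l.
have a0 : 0 < a by rewrite sqrtr_gt0.
have aa : a * a = l by rewrite -expr2 sqr_sqrtr// ltW.
pose y := - a^-1 *: (S *m x).
have Cy : C *m y = 0 by rewrite -scalemxAr Sinv ?scaler0.
have Sx : S *m x = - a *: y.
  by rewrite /y scalerA mulrNN divff ?scale1r// gt_eqF.
have Sy : S *m y = a *: x.
  by rewrite /y -scalemxAr SSx scalerA mulrNN -aa mulrA mulVf ?mul1r// gt_eqF.
have yy : dot y y = 1.
  by rewrite /y dotZl dotZr -/l -aa; field; rewrite gt_eqF.
have xy : dot x y = 0 by rewrite /y dotZr dot_skew0// mulr0.
have {}Cx := (CP _).1 Cx; have {}Cy := (CP _).1 Cy.
exists (fun i => if i == k then x else u i), (fun i => if i == k then y else v i),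
  (fun i => if i == k then a else d i).
split.
- move=> i; rewrite ltnS leq_eqVlt; case: eqVneq => [_ _|_ /= ik]; first by [].
  exact: eig.
- have lt_neq i : (i < k.+1)%N -> i != k -> (i < k)%N.
    by rewrite ltnS ltn_neqAle => -> ->.
  move=> i j /lt_neq Hi /lt_neq Hj.
  case: (eqVneq i k) Hi => [->|ik] Hi; case: (eqVneq j k) Hj => [->|jk] Hj;
    try have {}Hi := Hi isT; try have {}Hj := Hj isT.
  + by [].
  + have [ux vx] := Cx _ Hj; have [uy vy] := Cy _ Hj.
    by rewrite (dotC x (u j)) (dotC y (v j)) (dotC x (v j)).
  + have [ux vx] := Cx _ Hi; have [uy vy] := Cy _ Hi.
    by rewrite (negPf ik).
  + exact: orth.
- move=> i j; rewrite ltnS => /andP[ij jk].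
  case: (eqVneq j k) => [jE|jk']; last first.
    have jk0 : (j < k)%N by rewrite ltn_neqAle jk' jk.
    have ik0 := leq_ltn_trans ij jk0.
    by rewrite ltn_eqF// mono// ij.
  case: (eqVneq i k) => [//|ik].
  have ik0 : (i < k)%N by rewrite ltn_neqAle ik -jE ij.
  have di : 0 < d i by case: (eig _ ik0).
  rewrite -(@ler_pXn2r _ 2) ?nnegrE ?(ltW di) ?(ltW a0)//.
  by rewrite [a ^+ 2]expr2 aa -[d i ^+ 2]mulr1 -x1; apply: dmin => // l' /ltn_trans/(_ ik0) /Cx.
- move=> i z; rewrite ltnS leq_eqVlt.
  case: (eqVneq i k) => [->|_] /= Hi Hz.
    rewrite expr2 aa; apply: xmin; apply: (CP _).2 => j jk.
    by have := Hz _ jk; rewrite ltn_eqF.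
  apply: dmin => // j ji; have := Hz _ ji.
  by rewrite ltn_eqF// (ltn_trans ji).
Qed.

Lemma skew_pairs_exist m (S : 'M[R]_m) k : S^T = - S -> S \in unitmx ->
  (k + k <= m)%N -> exists u v d, skew_pairs S k u v d.
Proof.
move=> Sskew Su; elim: k => [_|k IH km].
  by exists (fun=> 0), (fun=> 0), (fun=> 0); split=> // i j; rewrite ltn0 andbF.
have km' : (k + k < m)%N by apply: leq_trans km; rewrite addSn addnS ltnS leqnSn.
have [u [v [d H]]] := IH (ltnW km').
exact: skew_pair_step H.
Qed.

End SkewNormalForm.

(** * Widths of ellipsoids as operator norms *)

Section Williamson.
Context {R : realType}.

Definition Jmx n : 'M[R]_(n + n) := block_mx 0 1%:M (- 1%:M) 0.

Lemma omega0E n (u v : 'cV[R]_(n + n)) : omega0 u v = dot u (Jmx n *m v).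
Proof.
rewrite -[u]vsubmxK -[v]vsubmxK /Jmx mul_block_col !mul0mx mul1mx add0r addr0 mulNmx mul1mx.
rewrite dotE big_split_ord/= -big_split/=; apply: eq_bigr => j _.
by rewrite /xcoord /ycoord !col_mxEu !col_mxEd [(- usubmx v) j 0]mxE mulrN.
Qed.

Lemma tr_Jmx n : (Jmx n)^T = - Jmx n.
Proof. by rewrite /Jmx tr_block_mx opp_block_mx !trmx0 linearN/= !trmx1 oppr0 opprK. Qed.

Lemma mulmx_Jmx n : Jmx n *m Jmx n = - 1%:M.
Proof.
rewrite /Jmx mulmx_block !mul0mx !mulmx0 mul1mx mulmx1 !(addr0, add0r).
by rewrite (scalar_mx_block n n 1) opp_block_mx oppr0.
Qed.

Lemma Jmx_unit n : Jmx n \in unitmx.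
Proof. by have /mulmx1_unit[] : Jmx n *m - Jmx n = 1%:M by rewrite mulmxN mulmx_Jmx opprK. Qed.

Lemma mulmx_rows m k p (M : 'M[R]_m) (u v : nat -> 'cV[R]_m) :
  (\matrix_(i < k) (u i)^T) *m M *m (\matrix_(i < p) (v i)^T)^T =
  \matrix_(i, j) dot (u i) (M *m v j).
Proof.
apply/matrixP => i j; rewrite -mulmxA !mxE /dot !mxE; apply: eq_bigr => l _.
by rewrite !mxE; congr (_ * _); apply: eq_bigr => l' _; rewrite !mxE.
Qed.

(** The rows of W are the vectors of a full set of n planes. *)
Lemma skew_normal_form n (S : 'M[R]_(n + n)) : (0 < n)%N -> S^T = - S -> S \in unitmx ->
  exists (W : 'M[R]_(n + n)) (d : nat -> R),
  [/\ W *m W^T = 1%:M,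
      W *m S *m W^T =
        block_mx 0 (diag_mx (\row_(i < n) d i)) (- diag_mx (\row_(i < n) d i)) 0,
      forall i, (i < n)%N -> 0 < d i, forall i j, (i <= j < n)%N -> d i <= d j &
      (forall x, d 0%N * enorm x <= enorm (S *m x)) /\
      exists2 x, x != 0 & enorm (S *m x) = d 0%N * enorm x].
Proof.
move=> n0 Sskew Su.
have [u [v [d [eig orth mono dmin]]]] := skew_pairs_exist Sskew Su (leqnn (n + n)).
exists (col_mx (\matrix_(i < n) (u i)^T) (\matrix_(i < n) (v i)^T)), d.
have entry i j : (i < n)%N -> (j < n)%N ->
    [/\ dot (u i) (S *m u j) = 0, dot (u i) (S *m v j) = (i == j)%:R * d i,
       dot (v i) (S *m u j) = - ((i == j)%:R * d i) & dot (v i) (S *m v j) = 0].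
  move=> Hi Hj; have [_ -> ->] := eig _ Hj.
  have [uu vv uv] := orth _ _ Hi Hj; have [_ _ vu] := orth _ _ Hj Hi.
  rewrite !dotZr uu vv uv (dotC (v i) (u j)) vu !mulr0; split=> //.
    by case: eqVneq => [->|]; rewrite ?mulr0 ?mul0r ?mulr1 ?mul1r.
  by case: eqVneq => [->|]; rewrite ?mulr0 ?mul0r ?mulr1 ?mul1r ?oppr0.
split.
- have block (u' v' : nat -> 'cV[R]_(n + n)) :
      (\matrix_(i < n) (u' i)^T) *m (\matrix_(i < n) (v' i)^T)^T =
      \matrix_(i, j) dot (u' i) (v' j).
    by rewrite -[X in X *m _]mulmx1 mulmx_rows; apply/matrixP => i j; rewrite !mxE mul1mx.
  rewrite tr_col_mx mul_col_row !block (scalar_mx_block n n 1).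
  congr block_mx; apply/matrixP => i j;
    have [uu vv uv] := orth _ _ (ltn_ord i) (ltn_ord j);
    have [_ _ vu] := orth _ _ (ltn_ord j) (ltn_ord i);
    by rewrite !mxE ?uu ?vv ?uv ?(dotC (v i)) ?vu.
- rewrite tr_col_mx mul_col_mx mul_col_row !mulmx_rows.
  congr block_mx; apply/matrixP => i j;
    have [uu uv vu vv] := entry _ _ (ltn_ord i) (ltn_ord j);
    rewrite !mxE ?uu ?uv ?vu ?vv //.
  by rewrite mulr_natl.
  by rewrite mulr_natl.
- by move=> i /eig[].
- exact: mono.
split=> [x|].
  have [d0 _ _] := eig _ n0.
  rewrite -(gtr0_norm d0) -enormZ enorm_le dotZl dotZr mulrA -expr2.
  exact: dmin.
exists (u 0%N); have [u0 _ _] := orth _ _ n0 n0; have [_ vv _] := orth _ _ n0 n0.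
  by rewrite -dot_gt0 u0 ltr01.
have [d0 -> _] := eig _ n0.
by rewrite enormZ normrN gtr0_norm// !enormE u0 vv.
Qed.

Lemma omega0_mulmx n (M : 'M[R]_(n + n)) u v :
  omega0 (M *m u) (M *m v) = dot u (M^T *m Jmx n *m M *m v).
Proof. by rewrite omega0E -!mulmxA [in RHS]dot_mulmxr trmxK. Qed.

Lemma symplectic_mulmx n (M : 'M[R]_(n + n)) :
  M^T *m Jmx n *m M = Jmx n -> symplectic (mulmx M).
Proof. by move=> MJM u v; rewrite /pullback/= omega0_mulmx MJM omega0E. Qed.

Lemma dot_isometry m (W : 'M[R]_m) v : W^T *m W = 1%:M -> dot (W *m v) (W *m v) = dot v v.
Proof. by move=> WW; rewrite dot_mulmxr mulmxA WW mul1mx. Qed.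

Lemma enorm_le1 m (v : 'cV[R]_m) : (enorm v <= 1) = (dot v v <= 1).
Proof. by rewrite enormE -[X in _ <= X]sqrtr1 ler_sqrt. Qed.

Lemma sqr_coords_sum n (v : 'cV[R]_(n + n)) :
  dot v v = \sum_(j < n) (xcoord v j ^+ 2 + ycoord v j ^+ 2).
Proof. by rewrite dotE big_split_ord/= -big_split. Qed.

Lemma mulmx_diag_coords n (e : 'rV[R]_n) (v : 'cV[R]_(n + n)) j :
  let D := block_mx (diag_mx e) 0 0 (diag_mx e) in
  xcoord (D *m v) j = e 0 j * xcoord v j /\ ycoord (D *m v) j = e 0 j * ycoord v j.
Proof.
rewrite -[v]vsubmxK /= mul_block_col !mul0mx addr0 add0r.
by rewrite /xcoord /ycoord !col_mxEu !col_mxEd !mul_diag_mx !mxE.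
Qed.

(** Bring S = A^T J A to its normal form W S W^T = D J D, with D the diagonal
    matrix of the square roots of the singular values.  Then D W A^-1 is
    symplectic and, W being orthogonal, maps E(A) onto the image of the unit
    ball under D.  So r_1^2 is the least dilation factor of S, which is the
    inverse of the norm of S^-1 = - B J B^T. *)
Lemma linear_width_opnorm n (A : 'M[R]_(n + n)) : (0 < n)%N -> A \in unitmx ->
  exists w, [/\ 0 < w, linear_width (ellipsoid A) w &
    w ^- 2 = opnorm (invmx A *m Jmx n *m (invmx A)^T)].
Proof.
move=> n0 Au.
pose B := invmx A; pose S := A^T *m Jmx n *m A.
have AB : A *m B = 1%:M by rewrite mulmxV.
have BA : B *m A = 1%:M by rewrite mulVmx.
have ATBT : A^T *m B^T = 1%:M by rewrite -trmx_mul BA trmx1.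
have BTAT : B^T *m A^T = 1%:M by rewrite -trmx_mul AB trmx1.
have Sskew : S^T = - S.
  by rewrite /S !trmx_mul trmxK tr_Jmx mulNmx mulmxN mulmxA.
have Su : S \in unitmx by rewrite !unitmx_mul unitmx_tr Au Jmx_unit.
have [W [d [WW WSW d_gt0 d_mono [smin [x0 x0_neq0 x0E]]]]] := skew_normal_form n0 Sskew Su.
have WTW : W^T *m W = 1%:M by exact: mulmx1C.
pose s : 'rV[R]_n := \row_(i < n) Num.sqrt (d i).
have s_gt0 i : 0 < s 0 i by rewrite mxE sqrtr_gt0 d_gt0.
pose D := block_mx (diag_mx s) 0 0 (diag_mx s).
pose D' := block_mx (diag_mx (map_mx (@GRing.inv R) s)) 0 0 (diag_mx (map_mx (@GRing.inv R) s)).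
have DD' : D *m D' = 1%:M.
  have ss' : diag_mx s *m diag_mx (map_mx (@GRing.inv R) s) = 1%:M.
    rewrite mulmx_diag -diag_const_mx; congr diag_mx; apply/rowP => i.
    by rewrite !mxE divff// gt_eqF// sqrtr_gt0 d_gt0.
  by rewrite mulmx_block !mulmx0 !mul0mx !(addr0, add0r) ss' -scalar_mx_block.
have DJD : D *m Jmx n *m D = W *m S *m W^T.
  rewrite WSW /D /Jmx !(mulmx_block, mulmx0, mul0mx, addr0, add0r) !(mulmxN, mulmx1) mulNmx.
  rewrite mulmx_diag.
  have -> : \row_j (s 0 j * s 0 j) = \row_i d i :> 'rV_n.
    by apply/rowP => i; rewrite !mxE -expr2 sqr_sqrtr// ltW// d_gt0.
  by [].
have DT : D^T = D by rewrite /D tr_block_mx !trmx0 !tr_diag_mx.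
pose M := D *m W *m B.
pose Psi : {linear 'cV[R]_(n + n) -> 'cV[R]_(n + n)} := mulmx M.
pose r : n.-tuple R := [tuple s 0 i | i < n].
have sum_r y : \sum_(j < n)
     (xcoord (D *m y) j ^+ 2 + ycoord (D *m y) j ^+ 2) / tnth r j ^+ 2 = dot y y.
  rewrite sqr_coords_sum; apply: eq_bigr => j _.
  have [-> ->] := mulmx_diag_coords s y j.
  rewrite tnth_mktuple !exprMn -mulrDr mulrC mulKf// expf_neq0// gt_eqF//.
have r0 : r`_0 = Num.sqrt (d 0%N).
  by rewrite -[0%N]/(val (Ordinal n0)) -tnth_nth tnth_mktuple mxE.
have spec : symplectic_spectrum (ellipsoid A) r.
  split.
  - by move=> j; rewrite tnth_mktuple.
  - apply/(sortedP 0) => i; rewrite size_tuple => Hi.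
    have Hi' := ltnW Hi.
    rewrite -[i.+1]/(val (Ordinal Hi)) -[X in nth _ _ X <= _]/(val (Ordinal Hi')).
    rewrite -!tnth_nth !tnth_mktuple !mxE ler_sqrt ?d_mono ?leqnSn//.
    by rewrite ltW// d_gt0.
  exists Psi.
    have MJM : M^T *m Jmx n *m M = Jmx n.
      rewrite /M !trmx_mul DT -!mulmxA (mulmxA (Jmx n)) (mulmxA D) (mulmxA D) DJD.
      rewrite -(mulmxA W S) -(mulmxA W) (mulmxA W^T W) WTW mul1mx -(mulmxA S).
      rewrite (mulmxA W^T W) WTW mul1mx /S -!mulmxA AB mulmx1.
      by rewrite mulmxA BTAT mul1mx.
    exact: symplectic_mulmx.
  apply/seteqP; split=> [_ [_ [y /= y1 <-] <-]|z].
    rewrite /std_ellipsoid/= /Psi/= /M -!mulmxA (mulmxA B) BA mul1mx sum_r.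
    by rewrite dot_isometry// -enorm_le1.
  rewrite /std_ellipsoid/= => z1.
  exists (A *m (W^T *m (D' *m z))).
    exists (W^T *m (D' *m z)) => //=.
    by rewrite /eball/= enorm_le1 dot_isometry ?trmxK// -sum_r mulmxA DD' mul1mx.
  rewrite /Psi/= /M -!mulmxA (mulmxA B) BA mul1mx (mulmxA W) WW mul1mx.
  by rewrite mulmxA DD' mul1mx.
exists (Num.sqrt (d 0%N)); split.
- by rewrite sqrtr_gt0 d_gt0.
- by left; exists A; split=> //; exists r.
have d0 : 0 < d 0%N by exact: d_gt0.
rewrite sqr_sqrtr ?ltW//.
have SB : S *m (B *m Jmx n *m B^T) = - 1%:M.
  rewrite /S -!mulmxA (mulmxA A) AB mul1mx (mulmxA (Jmx n)) mulmx_Jmx mulNmx mul1mx.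
  by rewrite mulmxN ATBT.
have BS : (B *m Jmx n *m B^T) *m S = - 1%:M.
  rewrite /S !mulmxA -(mulmxA _ B^T) BTAT mulmx1 -(mulmxA B) mulmx_Jmx.
  by rewrite mulmxN mulmx1 mulNmx BA.
apply/le_anti/andP; split.
  have := enorm_mulmx_opnorm (B *m Jmx n *m B^T) (S *m x0).
  rewrite mulmxA BS mulNmx mul1mx enormN x0E mulrA -[X in X <= _]mul1r.
  by rewrite ler_pM2r ?enorm_gt0// => H; rewrite -[leLHS]mul1r ler_pdivrMr.
apply: opnorm_le => [|v]; first by rewrite invr_ge0 ltW.
rewrite mulrC ler_pdivlMr// mulrC; apply: le_trans (smin _) _.
by rewrite mulmxA SB mulNmx mul1mx enormN.
Qed.

End Williamson.

(** * The hypotheses on Phi as inequalities between operator norms *)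

Section WidthTransfer.
Context {R : realType}.

Lemma linear_mulmx m p (f : {linear 'cV[R]_m -> 'cV[R]_p}) :
  exists P : 'M[R]_(p, m), forall v, f v = P *m v.
Proof.
exists (\matrix_(i, j) f (delta_mx j 0) i 0) => v.
rewrite {1}(matrix_sum_delta v) linear_sum; apply/colP => i.
rewrite summxE !mxE; apply: eq_bigr => j _.
by rewrite big_ord1 linearZ !mxE mulrC.
Qed.

Lemma image_ellipsoid m (f : {linear 'cV[R]_m -> 'cV[R]_m}) (P A : 'M[R]_m) :
  (forall v, f v = P *m v) -> f @` ellipsoid A = ellipsoid (P *m A).
Proof.
move=> fP; apply/seteqP; split=> [_ [_ [v v1 <-] <-]|_ [v v1 <-]].
  by exists v => //; rewrite fP mulmxA.
by exists (A *m v); [exists v|rewrite fP mulmxA].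
Qed.

Lemma rhoV_ge1 (eps : R) : 0 <= eps < 1 -> 0 <= (rho eps)^-1 - 1.
Proof.
move=> /andP[e0 e1]; have r0 : 0 < rho eps by rewrite sqrtr_gt0; lra.
rewrite subr_ge0 invf_ge1// /rho -[leRHS]sqrtr1 ler_sqrt//; lra.
Qed.

Lemma rhoV_le (eps : R) : 0 <= eps <= 2^-1 -> (rho eps)^-1 - 1 <= 2 * eps.
Proof.
move=> /andP[e0 e1].
have s0 : 0 < Num.sqrt (1 - eps) by rewrite sqrtr_gt0; lra.
have s1 : Num.sqrt (1 - eps) <= 1 by rewrite -[leRHS]sqrtr1 ler_sqrt//; lra.
have ss : Num.sqrt (1 - eps) ^+ 2 = 1 - eps by rewrite sqr_sqrtr//; lra.
rewrite lerBlDl /rho -[leLHS]mul1r ler_pdivrMr//.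
move: s0 s1 ss; set s := Num.sqrt _ => s0 s1 ss.
have se : 1 - eps <= s by rewrite -ss expr2 ler_piMl// ltW.
nra.
Qed.

(** Both the operator norm of A^-1 and the circumradius are dominated by entrywise
    norms. *)
Lemma distortion_bounds m (A : 'M[R]_m) eps a b : 0 <= eps < 1 -> 0 < a ->
  entry_norm A <= a -> entry_norm (invmx A) <= b ->
  0 <= distortion eps A <= b * ((rho eps)^-1 - 1) * a.
Proof.
move=> eps01 a0 Aa Bb; have d0 := rhoV_ge1 eps01.
have A_ball : 0 < a /\ ellipsoid A `<=` eball a.
  split=> // _ [v /= v1 <-]; apply: le_trans (enorm_mulmx_entry_norm _ _) _.
  by apply: le_trans Aa; rewrite ler_piMr ?entry_norm_ge0.
have lb0 : lbound [set r | 0 < r /\ ellipsoid A `<=` eball r] 0.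
  by move=> r [/ltW].
have c0 : 0 <= circumradius A by apply: lb_le_inf => //; exists a.
have ca : circumradius A <= a by apply: ge_inf => //; exists 0.
have o0 := opnorm_ge0 (invmx A).
have ob : opnorm (invmx A) <= b by apply: le_trans Bb; exact: opnorm_le_entry_norm.
rewrite /distortion !mulr_ge0//=.
by rewrite ler_pM ?mulr_ge0// ler_wpM2r.
Qed.

Section Transfer.
Variables (n : nat) (n_gt0 : (0 < n)%N) (eps : R) (eps01 : 0 <= eps < 1).
Variables (Phi : {linear 'cV[R]_(n + n) -> 'cV[R]_(n + n)}) (P : 'M[R]_(n + n)).
Hypothesis PhiE : forall v, Phi v = P *m v.

(** For singular P the image of the unit ball has width 0, while the unit ball has
    positive width. *)
Lemma non_squeezing_unit : linear_non_squeezing eps Phi -> P \in unitmx.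
Proof.
move=> nsq; apply/negPn/negP => Pu.
have [w [w0 wE _]] := linear_width_opnorm n_gt0 (unitmx1 R (n + n)).
have PhiEl : linear_width (Phi @` ellipsoid 1%:M) 0.
  by right; exists P; split=> //; rewrite (image_ellipsoid _ PhiE) mulmx1.
have := nsq _ _ _ (unitmx1 _ _) wE PhiEl.
have I0 : 0 < entry_norm (1%:M : 'M[R]_(n + n)) + 1.
  by rewrite ltr_wpDl ?entry_norm_ge0.
have /andP[d0 _] := distortion_bounds eps01 I0 (ler_wpDr ler01 (lexx _)) (lexx _).
by rewrite leNgt mulr_gt0// invr_gt0 ltr_wpDr.
Qed.

Let G := invmx P *m Jmx n *m (invmx P)^T.

(** G is the form that replaces J for the image of an ellipsoid, because
    (P A)^-1 J (P A)^-T = A^-1 G A^-T. *)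
Lemma width_image A : A \in unitmx -> P \in unitmx ->
  exists r1 R1, [/\ 0 < r1, 0 < R1,
    linear_width (ellipsoid A) r1, linear_width (Phi @` ellipsoid A) R1 &
    r1 ^- 2 = opnorm (invmx A *m Jmx n *m (invmx A)^T) /\
    R1 ^- 2 = opnorm (invmx A *m G *m (invmx A)^T)].
Proof.
move=> Au Pu.
have [r1 [r10 Er1 or1]] := linear_width_opnorm n_gt0 Au.
have PAu : P *m A \in unitmx by rewrite unitmx_mul Pu.
have [R1 [R10 ER1 oR1]] := linear_width_opnorm n_gt0 PAu.
exists r1, R1; split=> //; first by rewrite (image_ellipsoid _ PhiE).
have PAV : invmx (P *m A) = invmx A *m invmx P.
  apply: (can_inj (mulKmx PAu)).
  by rewrite mulmxV// mulmxA -(mulmxA P) mulmxV// mulmx1 mulmxV.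
by split=> //; rewrite oR1 PAV trmx_mul /G !mulmxA.
Qed.

Lemma non_squeezing_opnorm A t : linear_non_squeezing eps Phi -> A \in unitmx ->
  0 <= distortion eps A <= t ->
  opnorm (invmx A *m G *m (invmx A)^T) <=
  (1 + t) ^+ 2 * opnorm (invmx A *m Jmx n *m (invmx A)^T).
Proof.
move=> nsq Au /andP[d0 dt].
have [r1 [R1 [r0 R0 r1E R1E [<- <-]]]] := width_image Au (non_squeezing_unit nsq).
have := nsq _ _ _ Au r1E R1E.
rewrite /s_factor mulrC ler_pdivrMr ?ltr_wpDr// => H.
rewrite -[leLHS]mul1r ler_pdivrMr ?exprn_gt0// mulrAC ler_pdivlMr ?exprn_gt0//.
have t0 : 0 <= 1 + t by lra.
rewrite mul1r -exprMn ler_pXn2r ?nnegrE ?mulr_ge0 ?(ltW r0) ?(ltW R0)//.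
by apply: le_trans H _; rewrite mulrC ler_wpM2r ?(ltW R0)//; lra.
Qed.

Lemma non_expanding_opnorm A t : P \in unitmx -> linear_non_expanding eps Phi ->
  A \in unitmx -> 0 <= distortion eps A <= t -> t < 1 ->
  (1 - t) ^+ 2 * opnorm (invmx A *m Jmx n *m (invmx A)^T) <=
  opnorm (invmx A *m G *m (invmx A)^T).
Proof.
move=> Pu [_ nex] Au /andP[d0 dt] t1.
have [r1 [R1 [r0 R0 r1E R1E [<- <-]]]] := width_image Au Pu.
have := nex _ _ _ Au (le_lt_trans dt t1) r1E R1E.
have e0 : 0 < 1 - distortion eps A by lra.
rewrite /e_factor mulrC ler_pdivlMr// => H.
rewrite -[leRHS]mul1r ler_pdivlMr ?exprn_gt0// mulrAC ler_pdivrMr ?exprn_gt0//.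
have t0 : 0 <= 1 - t by lra.
rewrite mul1r -exprMn ler_pXn2r ?nnegrE ?mulr_ge0 ?(ltW r0) ?(ltW R0)//.
by apply: le_trans H; rewrite mulrC ler_wpM2l ?(ltW R0)//; lra.
Qed.

End Transfer.
End WidthTransfer.

(** * Comparing the two forms on a pair of vectors *)

Section PairEstimate.
Context {R : realType}.

Definition pair_weight m (i j : 'I_m) (t : R) : 'rV[R]_m :=
  \row_k (if (k == i) || (k == j) then 1 else t).

(** The matrix splits into the rank two skew matrix carried by the plane (i, j),
    whose norm is exactly |X i j|, and a remainder all of whose entries contain a
    factor t.  The exact constant 1 in front of |X i j| is what makes the
    comparison of the two forms sharp. *)
Lemma opnorm_skew_pair m (X : 'M[R]_m) i j t : X^T = - X -> 0 <= t <= 1 -> i != j ->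
  opnorm (diag_mx (pair_weight i j t) *m X *m diag_mx (pair_weight i j t)) <=
  `|X i j| + t * entry_norm X.
Proof.
move=> Xskew /andP[t0 t1] ij.
have skewE k l : X k l = - X l k by rewrite -[LHS]opprK -[in LHS](trmxK X) Xskew !mxE opprK.
have diag0 k : X k k = 0 by have := skewE k k; lra.
set D := diag_mx _.
pose T : 'M[R]_m := X i j *: (delta_mx i j - delta_mx j i).
rewrite -[D *m X *m D](subrK T) addrC.
apply: le_trans (opnormD _ _) _; apply: lerD.
  apply: opnorm_le => // v.
  have Tv : T *m v = X i j *: (v j 0 *: delta_mx i 0 - v i 0 *: delta_mx j 0).
    apply/colP => k; rewrite /T -scalemxAl mulmxBl !mxE !(mulr_natr, eqxx, andbT).
    have deltaE a b : \sum_l (delta_mx a b : 'M[R]_m) k l * v l 0 = (k == a)%:R * v b 0.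
      rewrite (bigD1 b)//= mxE eqxx andbT big1 ?addr0// => l lb.
      by rewrite mxE (negPf lb) andbF mul0r.
    by rewrite !deltaE !mulr_natl.
  rewrite Tv enormZ ler_wpM2l// enorm_le.
  rewrite !(dotDl, dotDr, dotNl, dotNr, dotZl, dotZr, dot_delta) !mxE !eqxx/=.
  rewrite (negPf ij) eq_sym (negPf ij) /=.
  rewrite [leRHS]dotE (bigD1 i)//= (bigD1 j) 1?eq_sym//=.
  have : 0 <= \sum_(k < m | (k != i) && (k != j)) v k 0 * v k 0.
    by apply: sumr_ge0 => k _; rewrite -expr2 sqr_ge0.
  lra.
apply: le_trans (opnorm_le_entry_norm _) _.
rewrite /entry_norm mulr_sumr; apply: ler_sum => k _.
rewrite mulr_sumr; apply: ler_sum => l _.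
have -> : (D *m X *m D - T) k l =
    pair_weight i j t 0 k * X k l * pair_weight i j t 0 l
    - X i j * (((k == i) && (l == j))%:R - ((k == j) && (l == i))%:R).
  by rewrite mul_mx_diag mul_diag_mx !mxE.
rewrite !mxE.
have tX : 0 <= t * `|X k l| by rewrite mulr_ge0.
have t_bound w : 0 <= w <= 1 -> `|t * X k l * w| <= t * `|X k l|.
  by move=> /andP[w0 w1]; rewrite !normrM (ger0_norm t0) (ger0_norm w0) ler_piMr.
have ji : (j == i) = false by rewrite eq_sym (negPf ij).
have [ki|ki] := eqVneq k i; last have [kj|kj] := eqVneq k j.
- have [li|li] := eqVneq l i; last have [lj|lj] := eqVneq l j.
  + by rewrite ki li diag0 (negPf ij) !(mulr0, mul0r) subr0 mulr0 subr0 normr0 mulr0.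
  + by rewrite lj ki (negPf ij) /= subr0 !mulr1 mul1r subrr normr0 mulr_ge0.
  + rewrite ki (negPf ij) /= subr0 mulr0 subr0 -ki mul1r mulrC.
    by have := t_bound 1; rewrite mulr1; apply; rewrite ler01 lexx.
- have [li|li] := eqVneq l i; last have [lj|lj] := eqVneq l j.
  + by rewrite li kj /= sub0r mulrN1 opprK mulr1 mul1r (skewE j i) addNr normr0 mulr_ge0.
  + by rewrite lj kj diag0 /= !(mulr0, mul0r) subr0 mulr0 subr0 normr0 mulr0.
  + rewrite /= subr0 mulr0 subr0 mul1r mulrC.
    by have := t_bound 1; rewrite mulr1; apply; rewrite ler01 lexx.
- rewrite /= subr0 mulr0 subr0; apply: t_bound.
  by case: ifP => _; rewrite ?ler01 ?lexx// t0.
Qed.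

Lemma entry_norm_diag_le m (e : 'rV[R]_m) c :
  (forall k, `|e 0 k| <= c) -> entry_norm (diag_mx e) <= m%:R * c.
Proof.
move=> ec; rewrite /entry_norm mulr_natl -[m in leRHS]card_ord -sumr_const.
apply: ler_sum => k _; rewrite (bigD1 k)//= mxE eqxx mulr1n big1 ?addr0// => l lk.
by rewrite mxE eq_sym (negPf lk) mulr0n normr0.
Qed.

Lemma entry_norm1 m : entry_norm (1%:M : 'M[R]_m) <= m%:R.
Proof.
rewrite -diag_const_mx -[leRHS]mulr1; apply: entry_norm_diag_le => k.
by rewrite mxE normr1.
Qed.

Lemma norm_Jmx_le1 n i j : `|Jmx n i j : R| <= 1.
Proof.
by rewrite /Jmx !mxE; case: splitP => a _; rewrite !mxE; case: splitP => b _;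
  rewrite !mxE ?normrN ?normr0// ?ler01// normr_nat lern1; case: eqP.
Qed.

Lemma entry_norm_Jmx n : entry_norm (Jmx n : 'M[R]_(n + n)) <= (n + n)%:R ^+ 2.
Proof.
rewrite expr2 -natrM -[leRHS]mulr1.
by apply: entry_norm_bound => i j; exact: norm_Jmx_le1.
Qed.

Lemma mulmx_pair_weightV m (i j : 'I_m) (t : R) : t != 0 ->
  diag_mx (pair_weight i j t) *m diag_mx (pair_weight i j t^-1) = 1%:M.
Proof.
move=> t0; rewrite mulmx_diag -diag_const_mx; congr diag_mx; apply/rowP => k.
by rewrite !mxE; case: ifP => _; rewrite ?mulr1// divff.
Qed.

(** The arithmetic of the comparison: l and h are the absolute values of the two
    forms on the chosen pair, oL and oH the norms of the two compressed forms,
    m4 and m6 powers of the dimension. *)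
Lemma two_sided_bound (t m4 m6 NL NH l h oL oH : R) :
  0 < t <= 2^-1 -> m4 <= m6 -> NL <= 4 * m4 -> NH <= 16 * m6 ->
  0 <= l <= NL -> (1 - t) ^+ 2 * oL <= oH -> oH <= (1 + t) ^+ 2 * oL ->
  l <= oL <= l + t * NL -> h <= oH <= h + t * NH -> `|l - h| <= 28 * (m6 * t).
Proof.
move=> /andP[t0 t2] m46 NL4 NH16 /andP[l0 lNL] oLH oHL /andP[loL oLl] /andP[hoH oHh].
have t3 : (1 + t) ^+ 2 <= 1 + 3 * t by nra.
have tle x y : x <= y -> t * x <= y * t by move=> xy; rewrite mulrC ler_wpM2r// ltW.
have tNL : t * NL <= 4 * m6 * t by apply: tle; lra.
have tl : t * l <= 4 * m6 * t by apply: tle; lra.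
have tNH : t * NH <= 16 * m6 * t by apply: tle; lra.
have tNL0 : 0 <= t * NL by rewrite mulr_ge0 ?(ltW t0)//; lra.
have upper : h <= l + 28 * (m6 * t).
  have s1 : (1 + t) ^+ 2 * oL <= (1 + 3 * t) * (l + t * NL).
    by rewrite ler_pM ?sqr_ge0//; lra.
  have s2 : t * (t * NL) <= 2^-1 * (t * NL) by rewrite ler_wpM2r.
  lra.
have lower : l <= h + 28 * (m6 * t).
  have s1 : (1 - t) ^+ 2 * l <= (1 - t) ^+ 2 * oL by rewrite ler_wpM2l ?sqr_ge0.
  have s2 : (1 - 2 * t) * l <= (1 - t) ^+ 2 * l by rewrite ler_wpM2r//; nra.
  lra.
by rewrite ler_norml; apply/andP; split; lra.
Qed.

Section Estimate.
Variables (n : nat) (n_gt0 : (0 < n)%N) (eps : R) (eps01 : 0 <= eps < 1).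
Variables (Phi : {linear 'cV[R]_(n + n) -> 'cV[R]_(n + n)}) (P : 'M[R]_(n + n)).
Hypothesis PhiE : forall v, Phi v = P *m v.
Hypothesis nsq : linear_non_squeezing eps Phi.

Let mu : R := (n + n)%:R.
Let G := invmx P *m Jmx n *m (invmx P)^T.
Let delta := (rho eps)^-1 - 1.

Lemma mu_ge1 : 1 <= mu.
Proof. by rewrite /mu ler1n addn_gt0 n_gt0. Qed.

(** Non-squeezing of the unit ball bounds the norm of G by a multiple of that of
    J. *)
Lemma entry_norm_pullback_dual : mu ^+ 2 * delta <= 1 -> entry_norm G <= 4 * mu ^+ 4.
Proof.
move=> mud; have mu1 := mu_ge1; have mu0 : 0 < mu by lra.
have I1 := entry_norm1 (n + n); rewrite -/mu in I1.
have dist : 0 <= distortion eps (1%:M : 'M[R]_(n + n)) <= 1.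
  have := distortion_bounds eps01 mu0 I1 (b := mu).
  rewrite invmx1 => /(_ I1) /andP[-> h]; apply: le_trans h _.
  by apply: le_trans mud; rewrite /delta; lra.
have := non_squeezing_opnorm n_gt0 eps01 PhiE nsq (unitmx1 _ _) dist.
rewrite invmx1 trmx1 !mul1mx !mulmx1 -/G => oG.
have {}oG : opnorm G <= 4 * mu ^+ 2.
  apply: le_trans oG _; have := opnorm_le_entry_norm (Jmx n : 'M[R]_(n + n)).
  have := entry_norm_Jmx n; rewrite -/mu; lra.
have := entry_norm_bound (fun i j => le_trans (entry_le_opnorm G i j) oG).
rewrite natrM -/mu => h; apply: le_trans h _.
by rewrite le_eqVlt; apply/orP; left; apply/eqP; ring.
Qed.

Hypothesis nex : linear_non_expanding eps Phi.

(** E(A), with A = C^-1 D^-1, is so elongated that its width only depends, up to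
    O(t), on the value of the form on the rows i and j of C.  The entrywise norm
    of A is O(1 / t), so the bound on t^2 keeps the distortion below t. *)
Lemma pair_estimate (C : 'M[R]_(n + n)) i j t : C \in unitmx ->
  entry_norm C <= 2 * mu -> entry_norm (invmx C) <= 2 * mu ->
  0 < t <= 2^-1 -> 4 * mu ^+ 4 * delta <= t ^+ 2 -> i != j ->
  `| `|(C *m G *m C^T) i j| - `|(C *m Jmx n *m C^T) i j| | <= 28 * mu ^+ 6 * t.
Proof.
move=> Cu NC NCV /andP[t0 t2] mud ij.
have mu1 := mu_ge1; have mu0 : 0 < mu by lra.
have delta0 : 0 <= delta by exact: rhoV_ge1.
have mu4 : 1 <= mu ^+ 4 by rewrite exprn_ege1.
have mu46 : mu ^+ 4 <= mu ^+ 6 by rewrite ler_weXn2l.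
have mu24 : mu ^+ 2 <= 4 * mu ^+ 4.
  by apply: (le_trans (ler_weXn2l mu1 (isT : (2 <= 4)%N))); lra.
pose D := diag_mx (pair_weight i j t).
pose D' := diag_mx (pair_weight i j t^-1).
have t_neq0 : t != 0 by rewrite gt_eqF.
have DD' : D *m D' = 1%:M by exact: mulmx_pair_weightV.
have [Du D'u] := mulmx1_unit DD'.
pose A := invmx C *m D'.
have Au : A \in unitmx by rewrite unitmx_mul unitmx_inv Cu.
have AV : invmx A = D *m C.
  apply: (can_inj (mulmxK Au)); rewrite mulVmx// /A mulmxA -(mulmxA D) mulmxV// mulmx1.
  by rewrite DD'.
have ND : entry_norm D <= mu.
  rewrite -[mu]mulr1; apply: entry_norm_diag_le => k; rewrite mxE.
  by case: ifP => _; rewrite ?normr1// gtr0_norm//; lra.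
have ND' : entry_norm D' <= mu / t.
  apply: entry_norm_diag_le => k; rewrite mxE.
  case: ifP => _; rewrite ?normr1.
    by rewrite invf_ge1//; lra.
  by rewrite gtr0_norm ?invr_gt0.
have NA : entry_norm A <= 2 * mu ^+ 2 / t.
  apply: le_trans (entry_normM _ _) _.
  have -> : 2 * mu ^+ 2 / t = (2 * mu) * (mu / t) by rewrite expr2; field.
  by rewrite ler_pM ?entry_norm_ge0.
have NAV : entry_norm (invmx A) <= 2 * mu ^+ 2.
  rewrite AV; apply: le_trans (entry_normM _ _) _.
  have -> : 2 * mu ^+ 2 = mu * (2 * mu) by ring.
  by rewrite ler_pM ?entry_norm_ge0.
have dist : 0 <= distortion eps A <= t.
  have a0 : 0 < 2 * mu ^+ 2 / t by rewrite divr_gt0 ?mulr_gt0 ?exprn_gt0.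
  have /andP[-> h] := distortion_bounds eps01 a0 NA NAV; apply: le_trans h _.
  rewrite -/delta mulrA ler_pdivrMr// -expr2; apply: le_trans mud.
  by rewrite le_eqVlt; apply/orP; left; apply/eqP; ring.
have Pu := non_squeezing_unit n_gt0 eps01 PhiE nsq.
have t1 : t < 1 by lra.
have oG := non_squeezing_opnorm n_gt0 eps01 PhiE nsq Au dist.
have oJ := non_expanding_opnorm n_gt0 PhiE Pu nex Au dist t1.
rewrite -/G in oG oJ.
have conj X : invmx A *m X *m (invmx A)^T = D *m (C *m X *m C^T) *m D.
  by rewrite AV trmx_mul /D tr_diag_mx !mulmxA.
rewrite !conj in oG oJ.
set H := C *m G *m C^T in oG oJ *; set L := C *m Jmx n *m C^T in oG oJ *.
have skew X : X^T = - X -> (C *m X *m C^T)^T = - (C *m X *m C^T).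
  by move=> XT; rewrite !trmx_mul trmxK XT mulNmx mulmxN mulmxA.
have NCX X : entry_norm (C *m X *m C^T) <= 4 * mu ^+ 2 * entry_norm X.
  apply: le_trans (entry_normM _ _) _; rewrite entry_norm_tr.
  have -> : 4 * mu ^+ 2 * entry_norm X = (2 * mu * entry_norm X) * (2 * mu) by ring.
  rewrite ler_pM ?entry_norm_ge0//; apply: le_trans (entry_normM _ _) _.
  by rewrite ler_wpM2r ?entry_norm_ge0.
have NL : entry_norm L <= 4 * mu ^+ 4.
  apply: le_trans (NCX _) _; have := entry_norm_Jmx n; rewrite -/mu => NJ.
  have -> : 4 * mu ^+ 4 = 4 * mu ^+ 2 * mu ^+ 2 by ring.
  by rewrite ler_wpM2l// mulr_ge0// exprn_ge0// ltW.
have NH : entry_norm H <= 16 * mu ^+ 6.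
  apply: le_trans (NCX _) _.
  have -> : 16 * mu ^+ 6 = 4 * mu ^+ 2 * (4 * mu ^+ 4) by ring.
  rewrite ler_wpM2l ?mulr_ge0 ?exprn_ge0 ?(ltW mu0)//.
  apply: entry_norm_pullback_dual.
  have tt : t ^+ 2 <= 1 by rewrite expr_le1 ?ltW.
  by apply: le_trans tt; apply: le_trans mud; rewrite ler_wpM2r.
have entryD X : (D *m X *m D) i j = X i j.
  by rewrite mul_mx_diag mul_diag_mx !mxE !eqxx orbT mul1r mulr1.
have LT : L^T = - L by apply: skew; exact: tr_Jmx.
have HT : H^T = - H.
  by apply: skew; rewrite /G !trmx_mul trmxK tr_Jmx mulNmx mulmxN mulmxA.
have t01 : 0 <= t <= 1 by rewrite !ltW.
have pairL := opnorm_skew_pair LT t01 ij; have pairH := opnorm_skew_pair HT t01 ij.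
rewrite -/D in pairL pairH.
have := entry_le_opnorm (D *m H *m D) i j; have := entry_le_opnorm (D *m L *m D) i j.
rewrite !entryD => Lij Hij.
have NLij := entry_le_entry_norm L i j.
rewrite -mulrA distrC.
apply: (two_sided_bound _ mu46 NL NH _ oJ oG); rewrite ?normr_ge0 ?(ltW t0) ?t0 //=.
- by rewrite Lij.
- by rewrite Hij.
Qed.

End Estimate.
End PairEstimate.

(** * Agreement of the signs *)

Section SignSelection.
Context {R : realType}.

Lemma Jmx_entry n (a b : 'I_n) :
  [/\ Jmx n (lshift n a) (lshift n b) = 0 :> R,
      Jmx n (lshift n a) (rshift n b) = (a == b)%:R :> R,
      Jmx n (rshift n a) (lshift n b) = - (a == b)%:R :> R &
      Jmx n (rshift n a) (rshift n b) = 0 :> R].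
Proof.
by rewrite /Jmx block_mxEul block_mxEur block_mxEdl block_mxEdr !mxE.
Qed.

(** Its rows lshift a and rshift a are e_a + e_k and f_a + f_k, a pair on which
    the standard form takes the value 2 if k is distinct from a. *)
Definition shear n (a k : 'I_n) : 'M[R]_(n + n) :=
  1%:M + delta_mx (lshift n a) (lshift n k) + delta_mx (rshift n a) (rshift n k).

(** The two elementary matrices have square zero and annihilate each other. *)
Lemma shear_inv n (a k : 'I_n) : a != k ->
  shear a k *m (1%:M - delta_mx (lshift n a) (lshift n k) - delta_mx (rshift n a) (rshift n k))
  = 1%:M.
Proof.
move=> ak; rewrite /shear; set E := delta_mx _ _; set F := delta_mx _ _.
have EE : E *m E = 0 by rewrite mul_delta_mx_0// eq_lshift eq_sym.
have FF : F *m F = 0 by rewrite mul_delta_mx_0// eq_rshift eq_sym.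
have EF : E *m F = 0 by rewrite mul_delta_mx_0// eq_lrshift.
have FE : F *m E = 0 by rewrite mul_delta_mx_0// eq_rlshift.
rewrite !mulmxDl !mulmxBr !mulmx1 !mul1mx EE FF EF FE !subr0.
by rewrite (addrAC _ (- F)) !subrK.
Qed.

Lemma shear_form n (a k : 'I_n) (X : 'M[R]_(n + n)) :
  (shear a k *m X *m (shear a k)^T) (lshift n a) (rshift n a) =
  X (lshift n a) (rshift n a) + X (lshift n a) (rshift n k) +
  X (lshift n k) (rshift n a) + X (lshift n k) (rshift n k).
Proof.
have rowl : (shear a k)^T *m delta_mx (lshift n a) 0 =
    delta_mx (lshift n a) 0 + delta_mx (lshift n k) 0 :> 'cV[R]_(n + n).
  rewrite !linearD/= trmx1 !trmx_delta !mulmxDl mul1mx mul_delta_mx.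
  by rewrite mul_delta_mx_0 ?addr0// eq_rlshift.
have rowr : (shear a k)^T *m delta_mx (rshift n a) 0 =
    delta_mx (rshift n a) 0 + delta_mx (rshift n k) 0 :> 'cV[R]_(n + n).
  rewrite !linearD/= trmx1 !trmx_delta !mulmxDl mul1mx mul_delta_mx.
  by rewrite mul_delta_mx_0 ?addr0// eq_lrshift.
rewrite [LHS]mx_entry_dot -[X in dot _ X]mulmxA rowr -mulmxA dot_mulmxr rowl.
rewrite mulmxDr !(dotDl, dotDr) -!mx_entry_dot; ring.
Qed.

Lemma entry_norm_shear n (a k : 'I_n) (s : R) : `|s| = 1 ->
  entry_norm (1%:M + s *: delta_mx (lshift n a) (lshift n k)
    + s *: delta_mx (rshift n a) (rshift n k)) <= 2 * (n + n)%:R.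
Proof.
move=> s1; have delta1 i j : entry_norm (delta_mx i j : 'M[R]_(n + n)) <= 1.
  rewrite /entry_norm (bigD1 i)//= (bigD1 j)//= mxE !eqxx normr1 big1 ?addr0; last first.
    by move=> l /negPf lj; rewrite mxE lj andbF normr0.
  rewrite big1 ?addr0// => l /negPf li; apply: big1 => p _.
  by rewrite mxE li normr0.
apply: le_trans (entry_normD _ _) _; rewrite entry_normZ s1 mul1r.
apply: le_trans (lerD (entry_normD _ _) (delta1 _ _)) _; rewrite entry_normZ s1 mul1r.
apply: le_trans (lerD (lerD (entry_norm1 _) (delta1 _ _)) (lexx _)) _.
have : 2 <= (n + n)%:R :> R.
  by rewrite ler_nat addnn; case: n a {k delta1} => [[]//|n' _]; rewrite doubleS.
lra.
Qed.

(** If ga and gk, both close to 1 in absolute value, had opposite signs, then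
    ga + y + x + gk would be small rather than close to 2 in absolute value. *)
Lemma sign_agreement (ga gk x y c : R) : c <= 4^-1 -> `|x| <= c -> `|y| <= c ->
  `| `|gk| - 1| <= c -> `| `|ga| - 1| <= c -> `| `|ga + y + x + gk| - 2| <= c ->
  (0 <= ga) = (0 <= gk).
Proof.
rewrite !ler_norml => c4 /andP[x1 x2] /andP[y1 y2].
have [ga0|ga0] := ger0P ga; have [gk0|gk0] := ger0P gk => //;
 have [s0|s0] := ger0P (ga + y + x + gk) => /andP[? ?] /andP[? ?] /andP[? ?]; lra.
Qed.

(** Taking C = 1 fixes each entry of G up to sign, and taking shears for C ties
    the sign on each symplectic pair to the sign on the first one. *)
Lemma close_to_Jmx n (n_gt0 : (0 < n)%N) (G : 'M[R]_(n + n)) c : G^T = - G -> c <= 4^-1 ->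
  (forall (C : 'M[R]_(n + n)) i j, C \in unitmx ->
    entry_norm C <= 2 * (n + n)%:R -> entry_norm (invmx C) <= 2 * (n + n)%:R ->
    i != j -> `| `|(C *m G *m C^T) i j| - `|(C *m Jmx n *m C^T) i j| | <= c) ->
  exists2 s : R, s = 1 \/ s = -1 & forall i j, `|(G - s *: Jmx n) i j| <= c.
Proof.
move=> Gskew c4 est.
have skewE k l : G k l = - G l k by rewrite -[LHS]opprK -[in LHS](trmxK G) Gskew !mxE opprK.
have diag0 k : G k k = 0 by have := skewE k k; lra.
have est1 i j : i != j -> `| `|G i j| - `|Jmx n i j| | <= c.
  have := est 1%:M i j (unitmx1 _ _); rewrite invmx1 trmx1 !mul1mx !mulmx1.
  have N1 : entry_norm (1%:M : 'M[R]_(n + n)) <= 2 * (n + n)%:R.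
    by apply: le_trans (entry_norm1 _) _; rewrite ler_peMl ?ler0n ?ler1n.
  by move=> /(_ N1 N1).
have c0 : 0 <= c.
  by apply: le_trans (normr_ge0 _) (est1 (lshift n (Ordinal n_gt0)) (rshift n (Ordinal n_gt0)) _); rewrite eq_lrshift.
have est1' i j : Jmx n i j = 0 :> R -> `|G i j| <= c.
  move=> Jij; have [<-|/est1] := eqVneq i j; last by rewrite Jij normr0 subr0 normr_id.
  by rewrite diag0 normr0.
pose a := Ordinal n_gt0.
have lr (k l : 'I_n) : lshift n k != rshift n l by rewrite eq_lrshift.
have est_lr k l : `| `|G (lshift n k) (rshift n l)| - (k == l)%:R | <= c.
  by have := est1 _ _ (lr k l); have [_ -> _ _] := Jmx_entry k l; rewrite normr_nat.
have same_sign k : (0 <= G (lshift n a) (rshift n a)) = (0 <= G (lshift n k) (rshift n k)).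
  have [->//|ka] := eqVneq k a; have ak : a != k by rewrite eq_sym.
  have inv := shear_inv ak; have [Cu _] := mulmx1_unit inv.
  have invE : invmx (shear a k) =
      1%:M - delta_mx (lshift n a) (lshift n k) - delta_mx (rshift n a) (rshift n k).
    by apply: (can_inj (mulKmx Cu)); rewrite mulmxV// inv.
  have NC : entry_norm (shear a k) <= 2 * (n + n)%:R.
    have := entry_norm_shear a k (normr1 R).
    by rewrite !scale1r.
  have NCV : entry_norm (invmx (shear a k)) <= 2 * (n + n)%:R.
    have := entry_norm_shear a k (normrN1 R).
    by rewrite invE !scaleN1r.
  have := est _ _ _ Cu NC NCV (lr a a).
  rewrite !shear_form//.
  have [_ -> _ _] := Jmx_entry a a; have [_ -> _ _] := Jmx_entry a k.
  have [_ -> _ _] := Jmx_entry k a; have [_ -> _ _] := Jmx_entry k k.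
  rewrite !eqxx (negPf ak) (negPf ka).
  have := est_lr a a; have := est_lr k k; have := est_lr a k; have := est_lr k a.
  rewrite !eqxx (negPf ak) (negPf ka) !subr0 !normr_id.
  move=> hx hy hk ha hS; apply: (sign_agreement c4 hx hy hk ha).
  suff <- : `|true%:R + false%:R + false%:R + true%:R| = 2 :> R by [].
  by rewrite !addr0 -natrD normr_nat.
pose s : R := if 0 <= G (lshift n a) (rshift n a) then 1 else -1.
exists s; first by rewrite /s; case: ifP; [left|right].
have main k l : `|G (lshift n k) (rshift n l) - s * (k == l)%:R| <= c.
  have := est_lr k l; have [->|_] := eqVneq k l; last by rewrite mulr0 !subr0 normr_id.
  rewrite mulr1 /s (same_sign l).
  by case: ger0P => // g0; rewrite opprK -opprD normrN.
move=> i j; have -> : (G - s *: Jmx n) i j = G i j - s * Jmx n i j by rewrite 3!mxE.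
case: (split_ordP i) => k ->; case: (split_ordP j) => l ->; have [Jll Jlr Jrl Jrr] := Jmx_entry k l.
- have := est1' (lshift n k) (lshift n l).
  by rewrite Jll mulr0 subr0 => /(_ erefl).
- by rewrite Jlr.
- rewrite Jrl skewE mulrN -opprD normrN eq_sym; exact: main.
- have := est1' (rshift n k) (rshift n l).
  by rewrite Jrr mulr0 subr0 => /(_ erefl).
Qed.

End SignSelection.

(** * Rigidity *)

Section Rigidity.
Context {R : realType}.

Lemma form_norm_le_entry_norm m (w : 'cV[R]_m -> 'cV[R]_m -> R) (X : 'M[R]_m) :
  (forall i j, w (delta_mx i 0) (delta_mx j 0) = X i j) -> form_norm w <= entry_norm X.
Proof.
move=> wX; rewrite -(ger0_norm (entry_norm_ge0 X)) -sqrtr_sqr ler_sqrt ?sqr_ge0//.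
rewrite expr2 {1}/entry_norm mulr_suml; apply: ler_sum => i _.
rewrite mulr_suml [leRHS](bigID (fun j : 'I_m => i < j)%N)/=.
apply: (@le_trans _ _ (\sum_(j < m | (i < j)%N) `|X i j| * entry_norm X)).
  apply: ler_sum => j _; rewrite wX -real_normK ?num_real// expr2.
  by rewrite ler_wpM2l// entry_le_entry_norm.
by rewrite lerDl sumr_ge0// => j _; rewrite mulr_ge0// entry_norm_ge0.
Qed.

(** From F G = - 1 and J J = - 1 one gets F - s J = s F (G - s J) J. *)
Lemma inverse_close_to_Jmx n (F G : 'M[R]_(n + n)) s c : let mu : R := (n + n)%:R in
  F *m G = - 1%:M -> s = 1 \/ s = -1 -> (forall i j, `|(G - s *: Jmx n) i j| <= c) ->
  mu ^+ 4 * c <= 2^-1 -> entry_norm (F - s *: Jmx n) <= 2 * mu ^+ 6 * c.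
Proof.
move=> mu FG s1 Gc cmu; pose E := G - s *: Jmx n.
have ss : s * s = 1 by case: s1 => ->; rewrite ?mulrNN mulr1.
have sn : `|s| = 1 by case: s1 => ->; rewrite ?normrN normr1.
have FJ : F - s *: Jmx n = s *: (F *m E *m Jmx n).
  rewrite /E mulmxBr FG -scalemxAr mulmxBl mulNmx mul1mx -scalemxAl -mulmxA mulmx_Jmx.
  by rewrite mulmxN mulmx1 scalerN opprK scalerDr scalerN scalerA ss scale1r addrC.
have mu0 : 0 <= mu by exact: ler0n.
have NJ : entry_norm (Jmx n : 'M[R]_(n + n)) <= mu ^+ 2 by exact: entry_norm_Jmx.
have NE : entry_norm E <= mu ^+ 2 * c.
  by rewrite expr2 /mu -natrM; exact: entry_norm_bound.
have NF0 := entry_norm_ge0 F; have NE0 := entry_norm_ge0 E.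
have NJ0 := entry_norm_ge0 (Jmx n : 'M[R]_(n + n)).
have NFJ : entry_norm (F - s *: Jmx n) <= entry_norm F * (mu ^+ 4 * c).
  rewrite FJ entry_normZ sn mul1r; apply: le_trans (entry_normM _ _) _.
  have -> : entry_norm F * (mu ^+ 4 * c) = entry_norm F * (mu ^+ 2 * c) * mu ^+ 2 by ring.
  apply: ler_pM => //; first exact: entry_norm_ge0.
  by apply: le_trans (entry_normM _ _) _; rewrite ler_wpM2l.
have NF : entry_norm F <= 2 * mu ^+ 2.
  have := entry_normD (F - s *: Jmx n) (s *: Jmx n).
  rewrite subrK entry_normZ sn mul1r => h.
  have : entry_norm F * (mu ^+ 4 * c) <= entry_norm F * 2^-1 by rewrite ler_wpM2l.
  lra.
apply: le_trans NFJ _.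
have -> : 2 * mu ^+ 6 * c = 2 * mu ^+ 2 * (mu ^+ 4 * c) by ring.
rewrite ler_wpM2r//.
have : 0 <= mu ^+ 2 * c by exact: le_trans NE0 NE.
have -> : mu ^+ 4 * c = mu ^+ 2 * (mu ^+ 2 * c) by ring.
by move=> h; rewrite mulr_ge0// exprn_ge0.
Qed.

(** The constant is 2 mu^6, from the inversion of G, times 28 mu^6, from
    [pair_estimate]. *)
Lemma quantitative_rigidity n (n_gt0 : (0 < n)%N) (eps t : R)
    (Phi : {linear 'cV[R]_(n + n) -> 'cV[R]_(n + n)}) : let mu : R := (n + n)%:R in
  0 <= eps < 1 -> 0 < t -> 56 * mu ^+ 12 * t <= 4^-1 ->
  4 * mu ^+ 4 * ((rho eps)^-1 - 1) <= t ^+ 2 ->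
  linear_non_squeezing eps Phi -> linear_non_expanding eps Phi ->
  eps_symplectic (56 * mu ^+ 12 * t) Phi \/ eps_antisymplectic (56 * mu ^+ 12 * t) Phi.
Proof.
move=> mu eps01 t0 t4 mud nsq nex.
have [P PhiE] := linear_mulmx Phi.
have Pu := non_squeezing_unit n_gt0 eps01 PhiE nsq.
have mu1 : 1 <= mu by exact: mu_ge1.
have pow k l : (k <= l)%N -> mu ^+ k * t <= mu ^+ l * t.
  by move=> kl; rewrite ler_wpM2r ?(ltW t0)// ler_weXn2l.
pose G := invmx P *m Jmx n *m (invmx P)^T.
have Gskew : G^T = - G.
  by rewrite /G !trmx_mul trmxK tr_Jmx mulNmx mulmxN mulmxA.
pose c := 28 * mu ^+ 6 * t.
have c4 : c <= 4^-1 by rewrite /c; have := pow 6%N 12%N isT; lra.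
have t12 : 0 < t <= 2^-1 by rewrite t0 /=; have := pow 0%N 12%N isT; rewrite expr0; lra.
have [|s s1 Gc] := close_to_Jmx n_gt0 Gskew c4.
  by move=> C i j Cu NC NCV ij; exact: (pair_estimate n_gt0 eps01 PhiE nsq nex Cu NC NCV t12 mud ij).
pose F := P^T *m Jmx n *m P.
have FG : F *m G = - 1%:M.
  rewrite /F /G !mulmxA -(mulmxA _ P) mulmxV// mulmx1 -(mulmxA P^T) mulmx_Jmx.
  by rewrite mulmxN mulmx1 mulNmx -trmx_mul mulVmx// trmx1.
have cmu : mu ^+ 4 * c <= 2^-1.
  have -> : mu ^+ 4 * c = 28 * (mu ^+ 10 * t) by rewrite /c; ring.
  have := pow 10%N 12%N isT; lra.
have := inverse_close_to_Jmx FG s1 Gc cmu.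
have -> : 2 * (n + n)%:R ^+ 6 * c = 56 * mu ^+ 12 * t by rewrite /c -/mu; ring.
have PhiF i j : pullback Phi (@omega0 R n) (delta_mx i 0) (delta_mx j 0) = F i j.
  by rewrite /pullback !PhiE omega0_mulmx -mx_entry_dot.
have JE i j : omega0 (delta_mx i 0) (delta_mx j 0) = Jmx n i j :> R.
  by rewrite omega0E -mx_entry_dot.
case: s1 => -> FJ; [left|right]; apply: le_trans FJ; apply: form_norm_le_entry_norm => i j.
  by rewrite PhiF JE scale1r [RHS]mxE; congr (_ + _); rewrite [RHS]mxE.
by rewrite PhiF JE scaleN1r opprK [RHS]mxE.
Qed.

End Rigidity.

Theorem theorem1p5 (R : realType) (n : nat) (n_gt0 : (0 < n)%N) :
  exists (eps0 : R) (K : R -> R),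
    [/\ 0 < eps0 <= 1,
        forall eps : R, 0 <= eps < eps0 -> 0 <= K eps,
        K eps @[eps --> 0^'+] --> 0 &
        forall eps : R, 0 <= eps < eps0 ->
        forall Phi : {linear 'cV[R]_(n + n) -> 'cV[R]_(n + n)},
          linear_non_squeezing eps Phi -> linear_non_expanding eps Phi ->
          eps_symplectic (K eps) Phi \/ eps_antisymplectic (K eps) Phi].
Proof.
pose mu : R := (n + n)%:R.
have mu1 : 1 <= mu by exact: mu_ge1.
pose k : R := 56 * mu ^+ 12.
have k0 : 0 < k by rewrite /k mulr_gt0 ?exprn_gt0//; lra.
pose c : R := k * (3 * mu ^+ 2).
have c0 : 0 < c by rewrite /c !mulr_gt0 ?exprn_gt0//; lra.
have c1 : 1 <= c.
  rewrite /c /k; have := exprn_ege1 12 mu1; have := exprn_ege1 2 mu1; nra.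
(* A defect u is reached by t = u / k; the hypothesis on eps is then the bound
   8 mu^4 eps <= t^2, as (rho eps)^-1 - 1 <= 2 eps; the factor 3 in c comes from
   8 <= 3^2. *)
have rigid u eps (Phi : {linear 'cV[R]_(n + n) -> 'cV[R]_(n + n)}) :
    0 < u <= 4^-1 -> 0 <= eps -> eps * c ^+ 2 <= u ^+ 2 ->
    linear_non_squeezing eps Phi -> linear_non_expanding eps Phi ->
    eps_symplectic u Phi \/ eps_antisymplectic u Phi.
  move=> /andP[u0 u4] e0 eu.
  have u_k : u = k * (u / k) by rewrite mulrC divfK// gt_eqF.
  have eps_half : eps <= 2^-1.
    have : eps <= eps * c ^+ 2 by rewrite ler_peMr// exprn_ege1.
    have : u ^+ 2 <= u by rewrite expr2 ler_piMl ?(ltW u0)//; lra.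
    lra.
  rewrite [u in eps_symplectic u]u_k [u in eps_antisymplectic u]u_k.
  apply: quantitative_rigidity => //; rewrite -/mu -?/k.
  - by rewrite e0; lra.
  - by rewrite divr_gt0.
  - by rewrite -u_k.
  have eps_half' : 0 <= eps <= 2^-1 by rewrite e0.
  apply: le_trans (ler_wpM2l _ (rhoV_le eps_half')) _.
    by rewrite mulr_ge0 ?exprn_ge0//; lra.
  rewrite expr_div_n ler_pdivlMr ?exprn_gt0//; apply: le_trans eu.
  have -> : eps * c ^+ 2 = 9 * (eps * mu ^+ 4 * k ^+ 2) by rewrite /c; ring.
  have -> : 4 * mu ^+ 4 * (2 * eps) * k ^+ 2 = 8 * (eps * mu ^+ 4 * k ^+ 2) by ring.
  have : 0 <= eps * mu ^+ 4 * k ^+ 2 by rewrite !mulr_ge0 ?exprn_ge0//; lra.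
  lra.
exists ((4 * c) ^- 2), (fun eps => c * Num.sqrt eps).
have c4 : 1 <= 4 * c by lra.
split.
- by rewrite invr_gt0 exprn_gt0 ?invf_le1 ?exprn_gt0 ?exprn_ege1//=; lra.
- by move=> eps _; rewrite mulr_ge0 ?sqrtr_ge0// ltW.
- apply: cvg_at_right_filter.
  have : {for (0 : R), continuous (fun eps : R => c * Num.sqrt eps)}.
    by apply: continuousM; [exact: cst_continuous|exact: sqrt_continuous].
  by rewrite /prop_for /continuous_at sqrtr0 mulr0.
move=> eps /andP[e0 e1] Phi nsq nex /=.
have [eps_gt0|eps_le0] := ltP 0 eps.
  apply: (rigid _ eps) => //; last by rewrite [leRHS]exprMn sqr_sqrtr// mulrC.
  rewrite mulr_gt0 ?sqrtr_gt0//=.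
  have : Num.sqrt eps <= (4 * c)^-1.
    rewrite -[leRHS]ger0_norm ?invr_ge0; last by lra.
    by rewrite -sqrtr_sqr ler_sqrt ?sqr_ge0// exprVn ltW.
  by rewrite -(ler_pM2l c0) invfM mulrCA mulfV ?mulr1// gt_eqF.
(* At eps = 0 every small positive defect is available, in particular one below
   both a and b if these were positive. *)
have eps0 : eps = 0 by apply/le_anti; rewrite eps_le0 e0.
rewrite eps0 sqrtr0 mulr0 /eps_symplectic /eps_antisymplectic.
set a := form_norm _; set b := form_norm _.
have [a0|a0] := leP a 0; first by left.
have [b0|b0] := leP b 0; first by right.
pose v := Num.min (Num.min a b) 4^-1.
have va : v <= a by rewrite /v !ge_min lexx.
have vb : v <= b by rewrite /v !ge_min lexx orbT.
have v4 : v <= 4^-1 by rewrite /v ge_min lexx orbT.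
have v0 : 0 < v by rewrite /v !lt_min a0 b0 /=; lra.
have u4 : 0 < v / 2 <= 4^-1 by lra.
have u2 : eps * c ^+ 2 <= (v / 2) ^+ 2 by rewrite eps0 mul0r sqr_ge0.
have := rigid _ _ _ u4 e0 u2 nsq nex.
rewrite /eps_symplectic /eps_antisymplectic -/a -/b => -[]; lra.
Qed.
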